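(* Let $(X,\mu)$ be a connected $d$-partite path complex which is a $\tfrac12$-top-link spectral expander. Then the spectral gap (Poincaré constant) of the down-up walk $P^\vee_d$ is at least $\frac{4}{d(d+1)^2}$. Consequently, for every facet $\tau\in X(d)$ and every $\epsilon>0$, $$t_\tau(\epsilon)\le \frac{d(d+1)^2}{4}\log\frac{1}{\epsilon\,\mu(\tau)}.$$
   Context: A simplicial complex $X$ on a finite ground set is a downward-closed family of subsets; $X(i)$ denotes faces of size $i$; $X$ is pure $d$-dimensional if all facets have size $d$; $\operatorname{codim}(\tau)=d-|\tau|$; the link of $\tau$ is $X_\tau=\{\sigma\setminus\tau:\sigma\in X,\sigma\supseteq\tau\}$. $X$ is $d$-partite if $X(1)=T_1\sqcup\dots\sqcup T_d$ with $|\sigma\cap T_i|=1$ for every facet $\sigma$ and every $i$. $\mu:X(d)\to\mathbb{R}_{>0}$ is a probability distribution on facets. For $\tau$ with $\operatorname{codim}(\tau)\ge 2$, $G_\tau$ is the weighted graph on $X_\tau(1)$ with edge set $X_\tau(2)$ and weights $w_\tau(F,G)=\mathbb{P}_{\sigma\sim\mu}[F,G\in\sigma\mid\tau\subseteq\sigma]$, and $P_\tau$ is its simple random walk matrix; $\lambda_2$ is the second largest eigenvalue. $(X,\mu)$ is connected if every such $G_\tau$ is connected; it is an $\alpha$-top-link spectral expander if $\lambda_2(P_\tau)\le\alpha$ whenever $\operatorname{codim}(\tau)=2$. $(X,\mu)$ is a path complex if (after possibly renaming parts) for all $1\le i<k-1\le d-1$, $F\in T_i$, $K\in T_k$ and every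 face $\tau$ with $\tau\cap\bigcup_{j=i+1}^{k-1}T_j\ne\emptyset$: $\mathbb{P}[F,K\in\sigma\mid\tau\subseteq\sigma]=\mathbb{P}[F\in\sigma\mid\tau\subseteq\sigma]\mathbb{P}[K\in\sigma\mid\tau\subseteq\sigma]$ ($\sigma\sim\mu$). The down-up walk $P^\vee_d$ on $X(d)$: from a facet $\sigma=\{F_1,\dots,F_d\}$ with $F_i\in T_i$, choose $i\in[d]$ uniformly at random and move to $\sigma'=\{F_1,\dots,F_{i-1},F,F_{i+1},\dots,F_d\}\in X(d)$ (over all $F\in T_i$ with $\sigma'\in X(d)$) with probability proportional to $\mu(\sigma')$. Its spectral gap is $\inf_f \mathcal{E}(f,f)/\mathrm{Var}_\mu(f)$ over non-constant $f:X(d)\to\mathbb{R}$, where $\mathcal{E}(f,f)=\tfrac12\sum_{x,y}\mu(x)P^\vee_d(x,y)(f(x)-f(y))^2$ and $\mathrm{Var}_\mu(f)=\mathbb{E}_\mu f^2-(\mathbb{E}_\mu f)^2$. The total variation mixing time from $\tau$ is $t_\tau(\epsilon)=\min\{t\in\mathbb{Z}_{\ge0}:\|(P^\vee_d)^t(\tau,\cdot)-\mu\|_1\le\epsilon\}$.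
   Formalization: The mixing bound is proved literally for d ≥ 2 and εμ(τ) ≤ 1; it fails for εμ(τ) > 1 (negative bound) and can fail for d = 1 (integer rounding), so for all d ≥ 1 and ε > 0 the bound proved is max(0, ⌈·⌉) of the right-hand side. *)

(* Defs.v *)
From HB Require Import structures.
From mathcomp Require Import all_boot all_order all_fingroup all_algebra.
From mathcomp Require Import polyrcf.
From mathcomp Require Import classical_sets reals ereal exp.

Set Implicit Arguments.
Unset Strict Implicit.
Unset Printing Implicit Defensive.

Import Order.TTheory GRing.Theory Num.Theory.

Local Open Scope ring_scope.

(** * Simplicial complexes *)

Definition simplicial_complex (V : finType) (X : {set {set V}}) : Prop :=
  forall s t : {set V}, s \in X -> t \subset s -> t \in X.

(* [faces X i] is X(i), the faces of SIZE i. *)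
Definition faces (V : finType) (X : {set {set V}}) (i : nat) : {set {set V}} :=
  [set s in X | #|s| == i]%SET.

(* X(1), its one-element faces being identified with their elements. *)
Definition vertices (V : finType) (X : {set {set V}}) : {set V} :=
  [set v | [set v]%SET \in X]%SET.

Definition is_facet (V : finType) (X : {set {set V}}) (s : {set V}) : Prop :=
  maxset (fun t : {set V} => t \in X) s.

Definition pure (V : finType) (X : {set {set V}}) (d : nat) : Prop :=
  forall s : {set V}, is_facet X s -> #|s| = d.

Definition codim (V : finType) (d : nat) (t : {set V}) : nat := (d - #|t|)%N.

Definition link (V : finType) (X : {set {set V}}) (t : {set V}) :
    {set {set V}} :=
  [set s :\: t | s in X & t \subset s]%SET.

Definition partite (V : finType) (X : {set {set V}}) (d : nat)
    (T : 'I_d -> {set V}) : Prop :=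
  [/\ forall v : V, v \in vertices X <-> exists i, v \in T i,
      forall i j : 'I_d, i != j -> [disjoint T i & T j]
    & forall s : {set V}, is_facet X s -> forall i, #|(s :&: T i)%SET| = 1%N].

(** * Distributions on facets *)

(* Only the values of mu on X(d) are meaningful. *)
Definition facet_distribution (R : realType) (V : finType)
    (X : {set {set V}}) (d : nat) (mu : {set V} -> R) : Prop :=
  (forall s, s \in faces X d -> 0 < mu s) /\ \sum_(s in faces X d) mu s = 1.

Definition prob (R : realType) (V : finType) (X : {set {set V}}) (d : nat)
    (mu : {set V} -> R) (A : pred {set V}) : R :=
  \sum_(s in faces X d | A s) mu s.

(* P_{s ~ mu}[ A s | t \subset s ] *)
Definition cprob (R : realType) (V : finType) (X : {set {set V}}) (d : nat)
    (mu : {set V} -> R) (A : pred {set V}) (t : {set V}) : R :=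
  prob X d mu (fun s => A s && (t \subset s)) /
  prob X d mu (fun s => t \subset s).

(** * The weighted graphs of the links and their random walks *)

Definition link_edge (V : finType) (X : {set {set V}}) (t : {set V}) : rel V :=
  fun F G => [set F; G]%SET \in faces (link X t) 2.

(* There are no loops: w_t(F, F) = 0. *)
Definition link_weight (R : realType) (V : finType) (X : {set {set V}})
    (d : nat) (mu : {set V} -> R) (t : {set V}) (F G : V) : R :=
  if link_edge X t F G
  then cprob X d mu (fun s => (F \in s) && (G \in s)) t
  else 0.

Definition link_walk (R : realType) (V : finType) (X : {set {set V}})
    (d : nat) (mu : {set V} -> R) (t : {set V}) :
    'M[R]_#|vertices (link X t)| :=
  \matrix_(i, j)
    (link_weight X d mu t (enum_val i) (enum_val j) /
     \sum_(H in vertices (link X t)) link_weight X d mu t (enum_val i) H).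

(* The real eigenvalues of A, repeated according to their algebraic
   multiplicity, in nonincreasing order. *)
Definition eigenvalues (R : realType) (n : nat) (A : 'M[R]_n) : seq R :=
  sort (fun x y => y <= x)
    (flatten [seq nseq (mup x (char_poly A)) x | x <- rootsR (char_poly A)]).

Definition lambda2 (R : realType) (n : nat) (A : 'M[R]_n) : R :=
  nth 0 (eigenvalues A) 1.

Definition connected_complex (V : finType) (X : {set {set V}}) (d : nat) :
    Prop :=
  forall t : {set V}, t \in X -> (2 <= codim d t)%N ->
  {in vertices (link X t) &, forall F G : V, connect (link_edge X t) F G}.

Definition top_link_expander (R : realType) (V : finType) (X : {set {set V}})
    (d : nat) (mu : {set V} -> R) (alpha : R) : Prop :=
  forall t : {set V}, t \in X -> codim d t = 2 ->
  lambda2 (link_walk X d mu t) <= alpha.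

(* The permutation p renames the parts; parts are numbered from 0. *)
Definition path_complex (R : realType) (V : finType) (X : {set {set V}})
    (d : nat) (T : 'I_d -> {set V}) (mu : {set V} -> R) : Prop :=
  exists p : 'S_d,
  forall (i k : 'I_d), (i.+1 < k)%N ->
  forall (F K : V), F \in T (p i) -> K \in T (p k) ->
  forall t : {set V}, t \in X ->
  (exists2 j : 'I_d, (i < j < k)%N & (t :&: T (p j))%SET != finset.set0) ->
  cprob X d mu (fun s => (F \in s) && (K \in s)) t =
  cprob X d mu (fun s => F \in s) t * cprob X d mu (fun s => K \in s) t.

(** * The down-up walk *)

(* For facets s and s', s' arises from s by replacing its element of T i by
   some (possibly the same) element of T i. *)
Definition replaces (V : finType) (d : nat) (T : 'I_d -> {set V}) (i : 'I_d)
    (s s' : {set V}) : bool :=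
  [exists F in T i, s' == (F |: (s :\: T i))%SET].

Definition down_up (R : realType) (V : finType) (X : {set {set V}}) (d : nat)
    (T : 'I_d -> {set V}) (mu : {set V} -> R) (s s' : {set V}) : R :=
  \sum_(i < d) d%:R^-1 *
    (if replaces T i s s'
     then mu s' / \sum_(r in faces X d | replaces T i s r) mu r
     else 0).

(* t-step transition probabilities of the walk on X(d). *)
Fixpoint down_up_iter (R : realType) (V : finType) (X : {set {set V}})
    (d : nat) (T : 'I_d -> {set V}) (mu : {set V} -> R) (t : nat)
    (s s' : {set V}) : R :=
  if t is t'.+1
  then \sum_(r in faces X d)
         down_up X T mu s r * down_up_iter X T mu t' r s'
  else (s == s')%:R.

Definition dirichlet (R : realType) (V : finType) (X : {set {set V}})
    (d : nat) (T : 'I_d -> {set V}) (mu : {set V} -> R) (f : {set V} -> R) : R :=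
  2^-1 * \sum_(x in faces X d) \sum_(y in faces X d)
           mu x * down_up X T mu x y * (f x - f y) ^+ 2.

Definition variance_on (R : realType) (V : finType) (X : {set {set V}})
    (d : nat) (mu : {set V} -> R) (f : {set V} -> R) : R :=
  \sum_(x in faces X d) mu x * f x ^+ 2 -
  (\sum_(x in faces X d) mu x * f x) ^+ 2.

Definition nonconstant_on (R : realType) (V : finType) (X : {set {set V}})
    (d : nat) (f : {set V} -> R) : Prop :=
  exists x y, [/\ x \in faces X d, y \in faces X d & f x <> f y].

(* Extended-real valued, the infimum being +oo when X has a single facet. *)
Definition spectral_gap (R : realType) (V : finType) (X : {set {set V}})
    (d : nat) (T : 'I_d -> {set V}) (mu : {set V} -> R) : \bar R :=
  ereal_inf [set g : \bar R | exists2 f : {set V} -> R, nonconstant_on X d f &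
               g = (dirichlet X T mu f / variance_on X d mu f)%:E]%classic.

Definition l1_distance (R : realType) (V : finType) (X : {set {set V}})
    (d : nat) (T : 'I_d -> {set V}) (mu : {set V} -> R) (tau : {set V})
    (t : nat) : R :=
  \sum_(s in faces X d) `|down_up_iter X T mu t tau s - mu s|.

(* A minimum over natural numbers, taken in the extended reals so that it is
   +oo if there is no such t. *)
Definition mixing_time (R : realType) (V : finType) (X : {set {set V}})
    (d : nat) (T : 'I_d -> {set V}) (mu : {set V} -> R) (tau : {set V})
    (eps : R) : \bar R :=
  ereal_inf [set g : \bar R | exists2 t : nat,
               l1_distance X T mu tau t <= eps & g = (t%:R)%:E]%classic.

(* This is negative when eps * mu tau > 1, and for d = 1 it can lie strictly
   between 0 and the (integral) mixing time: for mu uniform on two facets and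
   eps = 9/10 the mixing time is 1 but the bound is ln (20/9) < 1. *)
Definition mixing_bound (R : realType) (V : finType) (d : nat)
    (mu : {set V} -> R) (tau : {set V}) (eps : R) : R :=
  (d * d.+1 ^ 2)%:R / 4 * ln (1 / (eps * mu tau)).

(* Main.v *)
Require Import Defs.
From HB Require Import structures.
From mathcomp Require Import all_boot all_order all_fingroup all_algebra.
From mathcomp Require Import polyrcf complex.
From mathcomp Require Import classical_sets reals ereal sequences exp.
From mathcomp Require Import ring lra fintype finset.

(** In L^2(mu), let Q_i be the conditional expectation that resamples the
    vertex of part i, so that the down-up walk is the average of the Q_i, and
    put P_i = 1 - Q_i and L = sum_i P_i.  The top-link condition bounds the
    correlation of functions fixed by Q_i and by Q_j, inside each link of
    codimension 2, by 1/2; the path condition makes it 0 when i and j are not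
    consecutive.  Passing to the complementary projections, this gives
      2 <P_i f, P_j f> >= - eps (s |P_i f|^2 + |P_j f|^2 / s)
    for all s > 0, with eps = 1/2 or eps = 0 respectively.  Expanding |L f|^2
    and choosing s = phi_j / phi_i, phi_k = k (d + 1 - k), yields
      |L f|^2 >= 4 / (d + 1)^2 <L f, f>,
    hence every nonzero eigenvalue of L is at least 4 / (d + 1)^2.  As the links
    are connected, the kernel of L consists of the constants, and this is the
    spectral gap.  As the walk is positive semidefinite, the gap controls the
    decay of the chi-square distance to mu, and with it the mixing time. *)

Set Implicit Arguments.
Unset Strict Implicit.
Unset Printing Implicit Defensive.

Import Order.TTheory GRing.Theory Num.Theory.

Local Open Scope ring_scope.

(** * The second eigenvalue of a reversible walk *)

Lemma perm_eigenvalues (R : realType) (n : nat) (A : 'M[R]_n) (s : seq R) :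
  char_poly A = \prod_(x <- s) ('X - x%:P) -> perm_eq (eigenvalues A) s.
Proof.
move=> char_A; rewrite /eigenvalues char_A perm_sort; set p := \prod_(_ <- _) _.
have p_neq0 : p != 0 by rewrite monic_neq0 ?monic_prod_XsubC.
have -> : [seq nseq (mup x p) x | x <- rootsR p] =
    [seq nseq (count_mem x s) x | x <- rootsR p].
  by apply: eq_map => x; rewrite mu_prod_XsubC.
have rootsR_p : perm_eq (rootsR p) (undup s).
  apply: uniq_perm; rewrite ?undup_uniq ?uniq_roots // => x.
  by rewrite -(roots_on_rootsR p_neq0) mem_undup -root_prod_XsubC.
apply: perm_trans (perm_count_undup s).
by apply: perm_flatten; apply: perm_map.
Qed.

Lemma count_gt_sorted (R : realDomainType) (s : seq R) (c : R) :
  sorted >=%O s -> nth 0 s 1 <= c -> (count (> c) s <= 1)%N.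
Proof.
case: s => [|x [|y s]] //=; first by case: (c < x).
move=> /andP[_]; rewrite (path_sortedE ge_trans) => /andP[/allP y_max _] y_le.
rewrite [c < y]ltNge y_le (_ : count _ s = 0%N) ?addn0 ?leq_b1 //.
apply/eqP; rewrite -leqn0 leqNgt -has_count.
by apply/hasPn => z /y_max /le_trans/(_ y_le); rewrite leNgt.
Qed.

Lemma count_gt_lambda2 (R : realType) (n : nat) (A : 'M[R]_n) (s : seq R)
    (c : R) :
  char_poly A = \prod_(x <- s) ('X - x%:P) -> lambda2 A <= c ->
  (count (> c) s <= 1)%N.
Proof.
move=> /perm_eigenvalues/seq.permP <- /count_gt_sorted; apply.
by apply: sort_sorted => x y; exact: le_total.
Qed.

Lemma char_poly_simmx (F : fieldType) (n : nat) (P A B : 'M[F]_n) :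
  P \in unitmx -> P *m A = B *m P -> char_poly A = char_poly B.
Proof.
move=> P_unit PA_BP; pose polyP := map_mx polyC P.
have det_polyP : \det polyP != 0.
  by rewrite det_map_mx polyC_eq0 -unitfE -unitmxE.
have intertwine : polyP *m char_poly_mx A = char_poly_mx B *m polyP.
  by rewrite mulmxBr mulmxBl -!map_mxM PA_BP mul_mx_scalar mul_scalar_mx.
apply: (mulfI det_polyP).
by rewrite /char_poly -det_mulmx intertwine det_mulmx mulrC.
Qed.

Section HermitianMatrix.
Local Open Scope sesquilinear_scope.
Variables (C : numClosedFieldType) (n : nat) (A : 'M[C]_n).
Hypothesis A_herm : A \is hermsymmx.

Local Notation U := (spectralmx A).
Local Notation lam := (spectral_diag A 0).

Definition spectral_coord (u : 'rV[C]_n) : 'rV[C]_n := u *m U^t*.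

Lemma hermitian_spectral : A = U^t* *m diag_mx (spectral_diag A) *m U.
Proof.
rewrite -invmx_unitary ?spectral_unitarymx //.
exact/orthomx_spectralP/hermitian_normalmx.
Qed.

Lemma spectralmx_intertwine : U *m A = diag_mx (spectral_diag A) *m U.
Proof.
rewrite {2}hermitian_spectral !mulmxA.
by rewrite (unitarymxP (spectral_unitarymx A)) mul1mx.
Qed.

Lemma char_poly_hermitian : char_poly A = \prod_i ('X - (lam i)%:P).
Proof.
rewrite (char_poly_simmx (spectral_unit A) spectralmx_intertwine).
rewrite char_poly_trig ?diag_mx_is_trig //.
by apply: eq_bigr => i _; rewrite mxE eqxx mulr1n.
Qed.

Lemma spectral_coordK (u : 'rV[C]_n) : spectral_coord u *m U = u.
Proof. by rewrite mulmxKtV ?spectral_unitarymx. Qed.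

Lemma spectral_coord_adj (u : 'rV[C]_n) : U *m u^t* = (spectral_coord u)^t*.
Proof. by rewrite trmx_mul map_mxM trmxCK. Qed.

Lemma spectral_dotE (u v : 'rV[C]_n) :
  (u *m v^t*) 0 0 =
  \sum_i spectral_coord u 0 i * (spectral_coord v 0 i)^*.
Proof.
rewrite -{1}(spectral_coordK u) -mulmxA spectral_coord_adj mxE.
by apply: eq_bigr => i _; rewrite !mxE.
Qed.

Lemma spectral_coord_mul (u : 'rV[C]_n) i :
  spectral_coord (u *m A) 0 i = spectral_coord u 0 i * lam i.
Proof.
rewrite /spectral_coord {1}hermitian_spectral !mulmxA.
by rewrite -mulmxA (unitarymxP (spectral_unitarymx A)) mulmx1 mul_mx_diag mxE.
Qed.

Lemma spectral_formE (u : 'rV[C]_n) :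
  (u *m A *m u^t*) 0 0 = \sum_i lam i * `|spectral_coord u 0 i| ^+ 2.
Proof.
rewrite spectral_dotE; apply: eq_bigr => i _.
by rewrite spectral_coord_mul mulrAC normCK mulrC.
Qed.

(* The eigenvalue of [e] is the only one above [c], so [e] spans its eigenspace
   and the orthogonal complement of [e] is spanned by the other eigenvectors. *)
Lemma hermitian_form_le (e u : 'rV[C]_n) (a c : C) :
  c \is Num.real -> c < a -> e *m A = a *: e -> e != 0 ->
  (forall i j, c < lam i -> c < lam j -> i = j) ->
  (u *m e^t*) 0 0 = 0 -> (u *m A *m u^t*) 0 0 <= c * (u *m u^t*) 0 0.
Proof.
move=> c_real lt_ca eA e_neq0 lam_gt_uniq ue0.
have lam_e i : spectral_coord e 0 i != 0 -> lam i = a.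
  move=> ei; have := spectral_coord_mul e i.
  by rewrite eA /spectral_coord -scalemxAl mxE mulrC => /(mulfI ei).
have /rV0Pn[k ek] : spectral_coord e != 0.
  by apply: contraNneq e_neq0 => e0; rewrite -(spectral_coordK e) e0 mul0mx.
have lam_le i : i != k -> lam i <= c.
  have lam_real : lam i \is Num.real.
    exact: (mxOverP (hermitian_spectral_diag_real A_herm)).
  rewrite real_leNgt //; apply: contra => /lam_gt_uniq/(_ _)/eqP; apply.
  by rewrite (lam_e k ek).
have uk : spectral_coord u 0 k = 0.
  move: ue0; rewrite spectral_dotE (bigD1 k) //= big1 ?addr0.
    by move=> /eqP; rewrite mulf_eq0 conjC_eq0 (negPf ek) orbF => /eqP.
  move=> i /lam_le lam_i.
  have [->|/lam_e lam_a] := eqVneq (spectral_coord e 0 i) 0.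
    by rewrite conjC0 mulr0.
  by rewrite lam_a lt_geF in lam_i.
rewrite spectral_formE spectral_dotE mulr_sumr; apply: ler_sum => i _.
rewrite -normCK; have [->|/lam_le lam_i] := eqVneq i k.
  by rewrite uk normr0 expr0n !mulr0.
by rewrite ler_wpM2r ?exprn_ge0.
Qed.

End HermitianMatrix.

Section RealSymmetricMatrix.
Local Open Scope sesquilinear_scope.
Variables (R : rcfType) (n : nat) (S : 'M[R]_n).
Hypothesis S_sym : S^T = S.

Local Notation toC := (map_mx (real_complex R)).

Lemma real_complex_adj m k (A : 'M[R]_(m, k)) : (toC A)^t* = toC A^T.
Proof.
by apply/matrixP => i j; rewrite !mxE; apply/CrealP; rewrite complex_real.
Qed.

Lemma symmetric_hermitian : toC S \is hermsymmx.
Proof.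
by apply/is_hermitianmxP; rewrite expr0 scale1r real_complex_adj S_sym.
Qed.

Definition symmetric_diag (i : 'I_n) : R :=
  complex.Re (spectral_diag (toC S) 0 i).

Lemma symmetric_diagE i :
  real_complex R (symmetric_diag i) = spectral_diag (toC S) 0 i.
Proof.
apply: RRe_real; apply: (mxOverP (hermitian_spectral_diag_real _)).
exact: symmetric_hermitian.
Qed.

Lemma char_poly_symmetric :
  char_poly S = \prod_(x <- codom symmetric_diag) ('X - x%:P).
Proof.
apply: (map_poly_inj (real_complex R)).
rewrite map_char_poly (char_poly_hermitian symmetric_hermitian) rmorph_prod.
rewrite big_image /=; apply: eq_bigr => i _.
by rewrite -symmetric_diagE rmorphB /= map_polyX map_polyC.
Qed.

Lemma symmetric_form_le (e u : 'rV[R]_n) (a c : R) :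
  e *m S = a *: e -> e != 0 -> c < a ->
  (forall i j, c < symmetric_diag i -> c < symmetric_diag j -> i = j) ->
  u *m e^T = 0 -> (u *m S *m u^T) 0 0 <= c * (u *m u^T) 0 0.
Proof.
move=> eS e_neq0 lt_ca diag_gt_uniq ue0; rewrite -lecR rmorphM /=.
have toC_dot (v w : 'rV[R]_n) :
    real_complex R ((v *m w^T) 0 0) = (toC v *m (toC w)^t*) 0 0.
  by rewrite real_complex_adj -map_mxM [RHS]mxE.
rewrite !toC_dot map_mxM.
apply: (hermitian_form_le (e := toC e) (a := real_complex R a)
  symmetric_hermitian).
- by rewrite complex_real.
- by rewrite ltcR.
- by rewrite -map_mxM eS map_mxZ.
- by rewrite map_mx_eq0.
- by move=> i j; rewrite -!symmetric_diagE !ltcR; exact: diag_gt_uniq.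
- by rewrite -toC_dot ue0 mxE.
Qed.

End RealSymmetricMatrix.

Lemma symmetric_lambda2_le (R : realType) (n : nat) (S : 'M[R]_n)
    (e u : 'rV[R]_n) (a c : R) :
  S^T = S -> e *m S = a *: e -> e != 0 -> c < a -> lambda2 S <= c ->
  u *m e^T = 0 -> (u *m S *m u^T) 0 0 <= c * (u *m u^T) 0 0.
Proof.
move=> S_sym eS e_neq0 lt_ca lambda2_S.
apply: symmetric_form_le eS e_neq0 lt_ca _ => //.
have := count_gt_lambda2 (char_poly_symmetric S_sym) lambda2_S.
have -> : count (> c) (codom (symmetric_diag S)) =
    #|[pred k | c < symmetric_diag S k]|.
  by rewrite count_map -size_filter cardE enumT.
by move=> /card_le1_eqP diag_eq i j lam_i lam_j; exact/esym/diag_eq.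
Qed.

(* [P] is similar to the symmetric matrix [D^(-1/2) W D^(-1/2)], where [D] is
   the diagonal matrix of the degrees; the latter fixes the vector of their
   square roots. *)
Lemma reversible_lambda2_le (R : realType) (n : nat) (W P : 'M[R]_n)
    (g : 'I_n -> R) (c : R) :
  let deg i := \sum_j W i j in
  W^T = W -> (forall i, 0 < deg i) -> (forall i j, P i j = W i j / deg i) ->
  c < 1 -> lambda2 P <= c -> \sum_i deg i * g i = 0 ->
  \sum_i \sum_j W i j * (g i * g j) <= c * \sum_i deg i * g i ^+ 2.
Proof.
move=> deg W_sym deg_gt0 PE c_lt1 lambda2_P g_mean.
have [i0 _|no_index] := pickP (@predT 'I_n); last by rewrite !big_pred0 ?mulr0.
pose rt i := Num.sqrt (deg i).
have rt_neq0 i : rt i != 0 by rewrite gt_eqF // sqrtr_gt0.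
have rt_sqr i : deg i = rt i * rt i by rewrite -expr2 sqr_sqrtr // ltW.
pose S : 'M[R]_n := \matrix_(i, j) (W i j / (rt i * rt j)).
pose e : 'rV[R]_n := \row_i rt i.
pose u : 'rV[R]_n := \row_i (rt i * g i).
have WC i j : W i j = W j i by rewrite -{1}W_sym mxE.
have S_sym : S^T = S by apply/matrixP => i j; rewrite !mxE WC [rt j * _]mulrC.
have char_P : char_poly P = char_poly S.
  apply: (@char_poly_simmx _ _ (diag_mx e)).
    by rewrite unitmxE det_diag unitfE; apply/prodf_neq0 => i _; rewrite mxE.
  apply/matrixP => i j; rewrite mul_diag_mx mul_mx_diag !mxE PE rt_sqr.
  by field; rewrite !rt_neq0.
have lambda2_S : lambda2 S <= c by rewrite /lambda2 /eigenvalues -char_P.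
have e_fixed : e *m S = 1 *: e.
  apply/rowP => j; rewrite scale1r !mxE.
  rewrite (eq_bigr (fun i => W j i / rt j)) => [|i _]; last first.
    by rewrite !mxE WC; field; rewrite !rt_neq0.
  by rewrite -mulr_suml -/(deg j) rt_sqr mulfK.
have e_neq0 : e != 0 by apply/rV0Pn; exists i0; rewrite mxE.
have ue0 : u *m e^T = 0.
  apply/matrixP => i j; rewrite !ord1 mxE [RHS]mxE -[RHS]g_mean.
  by apply: eq_bigr => k _; rewrite !mxE rt_sqr; ring.
have := symmetric_lambda2_le S_sym e_fixed e_neq0 c_lt1 lambda2_S ue0.
have -> : (u *m u^T) 0 0 = \sum_i deg i * g i ^+ 2.
  by rewrite mxE; apply: eq_bigr => i _; rewrite !mxE rt_sqr; ring.
have -> // : (u *m S *m u^T) 0 0 = \sum_i \sum_j W i j * (g i * g j).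
rewrite exchange_big mxE; apply: eq_bigr => j _.
rewrite mxE mulr_suml; apply: eq_bigr => i _; rewrite !mxE.
by field; rewrite !rt_neq0.
Qed.

(** * Self-adjoint operators on a finite-dimensional inner product space *)

Section InnerProduct.
Variables (R : realFieldType) (H : vectType R) (dot : {dot H for @idfun R}).
Implicit Types (A B : 'End(H)) (f g x y z : H).

Local Notation "''[' x , y ]" := (dot x%R y%R) : ring_scope.
Local Notation "''[' x ]" := '[x, x] : ring_scope.

Definition self_adjoint A := forall x y, '[A x, y] = '[x, A y].

Definition psd A := forall x, 0 <= '[A x, x].

Definition orthogonal_projection A :=
  self_adjoint A /\ forall x, A (A x) = A x.

Lemma dotC x y : '[x, y] = '[y, x].
Proof. by rewrite hermC expr0 mul1r. Qed.

(* The bilinearity lemmas of the library, restated for the coercion of [dot]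
   itself rather than for that of its underlying bilinear map. *)
Lemma dot0r x : '[x, 0] = 0.
Proof. exact: linear0r. Qed.

Lemma dot0l x : '[0, x] = 0.
Proof. exact: linear0l. Qed.

Lemma dotDl x y z : '[x + y, z] = '[x, z] + '[y, z].
Proof. exact: linearDl. Qed.

Lemma dotDr x y z : '[x, y + z] = '[x, y] + '[x, z].
Proof. exact: linearDr. Qed.

Lemma dotBl x y z : '[x - y, z] = '[x, z] - '[y, z].
Proof. exact: linearBl. Qed.

Lemma dotBr x y z : '[x, y - z] = '[x, y] - '[x, z].
Proof. exact: linearBr. Qed.

Lemma dotZl a x y : '[a *: x, y] = a * '[x, y].
Proof. exact: linearZl_LR. Qed.

Lemma dotZr a x y : '[x, a *: y] = a * '[x, y].
Proof. exact: linearZr_LR. Qed.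

Lemma dot_suml (I : Type) (r : seq I) (P : pred I) (F : I -> H) x :
  '[\sum_(i <- r | P i) F i, x] = \sum_(i <- r | P i) '[F i, x].
Proof. exact: linear_sumlz. Qed.

Lemma dot_sumr (I : Type) (r : seq I) (P : pred I) (F : I -> H) x :
  '[x, \sum_(i <- r | P i) F i] = \sum_(i <- r | P i) '[x, F i].
Proof. exact: linear_sumr. Qed.

Let dotE := (dotBl, dotBr, dotDl, dotDr, dotZl, dotZr).

Lemma dot_scale_sub a x y :
  '[a *: x - y] = a ^+ 2 * '[x] - 2 * a * '[y, x] + '[y].
Proof. by rewrite !dotE [dot x y]dotC; ring. Qed.

Lemma dot_gt0 x : x != 0 -> 0 < '[x].
Proof. exact: neq0_dnorm_gt0. Qed.

Lemma dot_ge0 x : 0 <= '[x].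
Proof. by have [->|/dot_gt0/ltW//] := eqVneq x 0; rewrite dot0r. Qed.

Lemma dot_eq0 x : ('[x] == 0) = (x == 0).
Proof.
have [->|/dot_gt0 x_gt0] := eqVneq x 0; first by rewrite dot0r eqxx.
by rewrite gt_eqF.
Qed.

Lemma psd_young A x y s : self_adjoint A -> psd A -> 0 < s ->
  2 * '[A x, y] <= s * '[A x, x] + s^-1 * '[A y, y].
Proof.
move=> A_sa A_psd s_gt0.
have : 0 <= s * (s * '[A x, x]) - 2 * (s * '[A x, y]) + '[A y, y].
  have := A_psd (s *: x - y).
  have -> : A (s *: x - y) = s *: A x - A y by rewrite linearB linearZ.
  rewrite !dotE [dot (A y) x]A_sa [dot y _]dotC; lra.
rewrite -(ler_pM2l s_gt0) [s * (_ + _)]mulrDr mulVKf ?gt_eqF //; lra.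
Qed.

Lemma dot_projection A x : orthogonal_projection A -> '[A x] = '[A x, x].
Proof. by move=> [A_sa A_idem]; rewrite -A_sa A_idem. Qed.

Lemma dot_complement A x : orthogonal_projection A ->
  '[x - A x] = '[x] - '[A x, x].
Proof.
by move=> A_proj; rewrite !dotE dot_projection // [dot x (A x)]dotC; ring.
Qed.

Lemma sum_projections_ker A B x : orthogonal_projection A ->
  orthogonal_projection B -> A x + B x = 0 -> A x = 0 /\ B x = 0.
Proof.
move=> [A_sa A_idem] [B_sa B_idem] ABx.
have : '[A x] + '[B x] = 0.
  by rewrite [X in X + _]A_sa [X in _ + X]B_sa A_idem B_idem -dotDr ABx dot0r.
move/eqP; rewrite paddr_eq0 ?dot_ge0 // !dot_eq0.
by move=> /andP[/eqP -> /eqP ->].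
Qed.

Lemma self_adjoint_split A f : self_adjoint A ->
  exists2 f0, A f0 = 0 & exists g, f = f0 + A g.
Proof.
move=> A_sa; pose A2 := (A \o A)%VF.
have lker_A2 : lker A2 = lker A.
  apply/vspaceP => x; rewrite !memv_ker comp_lfunE.
  apply/eqP/eqP => [AAx|->]; last by rewrite linear0.
  by apply/eqP; rewrite -dot_eq0 A_sa AAx dot0r.
have limg_A2 : limg A2 = limg A.
  apply/eqP; rewrite eqEdim limg_comp limgS ?subvf //=.
  have := limg_ker_dim A2 fullv.
  rewrite lker_A2 -(limg_ker_dim A fullv) limg_comp.
  by move/eqP; rewrite eqn_add2l => /eqP ->.
have /memv_imgP[g _ Afg] : A f \in limg A2 by rewrite limg_A2 memv_img ?memvf.
exists (f - A g); last by exists g; rewrite subrK.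
by rewrite linearB /= Afg comp_lfunE subrr.
Qed.

Lemma self_adjoint_absorb A B : self_adjoint A -> self_adjoint B ->
  (forall x, A (B x) = B x) -> forall x, B (A x) = B x.
Proof.
move=> A_sa B_sa AB x; apply/eqP; rewrite -subr_eq0 -dot_eq0.
by rewrite {1}dotBl !B_sa A_sa AB subrr.
Qed.

(* If the ranges of [A] and [B] have correlation at most [eps] orthogonally to
   the range of [N], then [S = A + B] satisfies [S <= 1 + eps] there.  Since
   [(1 + eps - S) (2 - S) = (1 + eps - S)^2 + (1 - eps) (1 + eps - S)] is then
   nonnegative, [2 - S], which vanishes on the range of [N], satisfies
   [(2 - S)^2 >= (1 - eps) (2 - S)]; this is the case [s = 1] below. *)
Section Correlation.
Variables (A B N : 'End(H)) (eps : R).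
Hypothesis A_proj : orthogonal_projection A.
Hypothesis B_proj : orthogonal_projection B.
Hypothesis N_proj : orthogonal_projection N.
Hypothesis AN : forall x, A (N x) = N x.
Hypothesis BN : forall x, B (N x) = N x.
Hypothesis eps_ge0 : 0 <= eps.
Hypothesis eps_le1 : eps <= 1.
Hypothesis range_correlation_le : forall a b, A a = a -> B b = b ->
  N a = 0 -> N b = 0 -> 2 * '[a, b] <= eps * ('[a] + '[b]).

Lemma sum_projections_sqr_le x : N x = 0 ->
  '[A x + B x] <= (1 + eps) * '[A x + B x, x].
Proof.
move=> Nx; have [A_sa A_idem] := A_proj; have [B_sa B_idem] := B_proj.
have [N_sa _] := N_proj.
have := range_correlation_le (A_idem x) (B_idem x).
rewrite (self_adjoint_absorb A_sa N_sa AN) (self_adjoint_absorb B_sa N_sa BN).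
move=> /(_ Nx Nx); rewrite !dotE [dot (B x) (A x)]dotC.
rewrite (dot_projection x A_proj) (dot_projection x B_proj); lra.
Qed.

Lemma sum_projections_le x : N x = 0 -> '[A x + B x, x] <= (1 + eps) * '[x].
Proof.
move=> Nx; have := sum_projections_sqr_le Nx.
have := dot_ge0 ((1 + eps) *: x - (A x + B x)).
rewrite dot_scale_sub => sq_ge0 sqr_le.
rewrite -(ler_pM2l (_ : 0 < 1 + eps)); last by rewrite ltr_wpDr.
lra.
Qed.

Lemma sum_complements_ge x :
  (1 - eps) * ('[x - A x] + '[x - B x]) <= '[(x - A x) + (x - B x)].
Proof.
wlog Nx : x / N x = 0 => [wlogN|].
  have := wlogN (x - N x); have [_ N_idem] := N_proj.
  rewrite (linearB A) (linearB B) (linearB N) /= AN BN N_idem subrr.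
  move=> /(_ erefl).
  by rewrite !opprB !subrKA.
have -> : (x - A x) + (x - B x) = 2 *: x - (A x + B x).
  by rewrite addrACA -opprD scaler_nat mulr2n.
rewrite dot_scale_sub !dot_complement // addrACA -opprD -(dotDl (A x)).
have := dot_ge0 ((1 + eps) *: x - (A x + B x)); rewrite dot_scale_sub.
have : 0 <= (1 - eps) * ((1 + eps) * '[x] - '[A x + B x, x]).
  by rewrite mulr_ge0 ?subr_ge0 ?sum_projections_le.
lra.
Qed.

Lemma complement_correlation_ge f s : 0 < s ->
  - eps * (s * '[f - A f] + s^-1 * '[f - B f]) <= 2 * '[f - A f, f - B f].
Proof.
move=> s_gt0; have [A_sa A_idem] := A_proj; have [B_sa B_idem] := B_proj.
have S_sa : self_adjoint (A + B)%VF.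
  by move=> x y; rewrite !add_lfunE !dotE A_sa B_sa.
have [f0] := self_adjoint_split f S_sa; rewrite add_lfunE.
move=> /(sum_projections_ker A_proj B_proj)[Af0 Bf0] [g].
rewrite add_lfunE => fE.
set u := B g - A (B g); set v := A g - B (A g).
have fA : f - A f = f0 + u.
  rewrite fE !(linearD A) /= Af0 A_idem add0r -addrA.
  by rewrite opprD addrACA subrr add0r.
have fB : f - B f = f0 + v.
  rewrite fE !(linearD B) /= Bf0 B_idem add0r -addrA.
  by rewrite opprD addrACA subrr addr0.
have orth_u : '[f0, u] = 0 by rewrite dotBr -A_sa -B_sa Af0 Bf0 !dot0l subrr.
have orth_v : '[f0, v] = 0 by rewrite dotBr -A_sa -B_sa Af0 Bf0 !dot0l subrr.
(* Scaling the component of [f] in the range of [B] reduces to [s = 1]. *)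
have := sum_complements_ge (s *: B g + A g).
rewrite (linearP A) (linearP B) /= A_idem B_idem.
have -> : s *: B g + A g - (s *: A (B g) + A g) = s *: u.
  by rewrite opprD addrACA subrr addr0 scalerBr.
have -> : s *: B g + A g - (s *: B g + B (A g)) = v.
  by rewrite opprD addrACA subrr add0r.
rewrite fA fB; clearbody u v.
rewrite !dotE orth_u orth_v [dot u f0]dotC [dot v f0]dotC orth_u orth_v.
rewrite [dot v u]dotC !addr0 !add0r => uv_ge.
have f0_ge0 := dot_ge0 f0.
have sf0_ge0 : 0 <= s * '[f0] by rewrite mulr_ge0 // ltW.
have ef0_ge0 : 0 <= eps * '[f0] by rewrite mulr_ge0.
have esf0_ge0 : 0 <= eps * (s * (s * '[f0])) by rewrite !mulr_ge0 // ltW.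
rewrite -(ler_pM2l s_gt0) mulrCA [s * (_ + _)]mulrDr mulVKf ?gt_eqF //.
lra.
Qed.

End Correlation.

(* The Schur test: [s] is taken to be [phi j / phi i]. *)
Lemma sqr_norm_sum_ge (I : finType) (u : I -> H) (c : I -> I -> R)
    (phi : I -> R) (gam : R) :
  (forall i j, c i j = c j i) -> (forall i, 0 < phi i) ->
  (forall i j s, i != j -> 0 < s ->
     - c i j * (s * '[u i] + s^-1 * '[u j]) <= 2 * '[u i, u j]) ->
  (forall i, \sum_(j | j != i) c i j * phi j <= (1 - gam) * phi i) ->
  gam * \sum_i '[u i] <= '[\sum_i u i].
Proof.
move=> c_sym phi_gt0 corr_ge phi_super.
pose t i j := c i j * (phi j / phi i * '[u i]).
have t_ge i j : j != i -> - (t i j + t j i) <= 2 * '[u i, u j].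
  rewrite eq_sym => ij; have := corr_ge i j (phi j / phi i) ij.
  by rewrite /t (c_sym j i) -mulrDr -mulNr invf_div; apply; rewrite divr_gt0.
have t_sum_le : \sum_i \sum_(j | j != i) t i j <= (1 - gam) * \sum_i '[u i].
  rewrite mulr_sumr; apply: ler_sum => i _.
  have -> : \sum_(j | j != i) t i j =
      (\sum_(j | j != i) c i j * phi j) / phi i * '[u i].
    by rewrite !mulr_suml; apply: eq_bigr => j _; rewrite /t !mulrA.
  by rewrite ler_wpM2r ?dot_ge0 // ler_pdivrMr.
have : - (2 * \sum_i \sum_(j | j != i) t i j) <=
    2 * \sum_i \sum_(j | j != i) '[u i, u j].
  have -> : 2 * \sum_i \sum_(j | j != i) t i j =
      \sum_i \sum_(j | j != i) (t i j + t j i).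
    rewrite mulr_natl mulr2n {2}(exchange_big_dep xpredT) //= -big_split /=.
    apply: eq_bigr => i _; rewrite big_split /=; congr (_ + _).
    by apply: eq_bigl => j; rewrite eq_sym.
  rewrite mulr_sumr -sumrN; apply: ler_sum => i _.
  by rewrite mulr_sumr -sumrN; apply: ler_sum => j; exact: t_ge.
have -> : '[\sum_i u i] = \sum_i '[u i] + \sum_i \sum_(j | j != i) '[u i, u j].
  rewrite dot_suml -big_split; apply: eq_bigr => i _ /=.
  by rewrite dot_sumr (bigD1 i).
lra.
Qed.

Lemma psd_spectral_gap L gam f : self_adjoint L -> psd L -> 0 < gam ->
  (forall x, gam * '[L x, x] <= '[L x]) ->
  exists2 f0, L f0 = 0 & gam * '[f - f0] <= '[L f, f].
Proof.
move=> L_sa L_psd gam_gt0 L2_ge.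
have [f0 Lf0 [g ->]] := self_adjoint_split f L_sa; exists f0 => //.
rewrite addrAC subrr add0r (linearD L) /= Lf0 add0r dotDr.
rewrite [dot (L (L g)) f0]L_sa Lf0 dot0r add0r.
rewrite -ler_pdivlMl //; have := L2_ge g.
have := psd_young g (L g) L_sa L_psd gam_gt0; lra.
Qed.

Lemma psd_contraction A r x : self_adjoint A -> psd A -> 0 <= r ->
  '[A x, x] <= r * '[x] -> '[A (A x), A x] <= r * '[A x] ->
  '[A x] <= r ^+ 2 * '[x].
Proof.
move=> A_sa A_psd; rewrite le_eqVlt => /predU1P[<-|r_gt0] A_le AA_le.
  have := psd_young x (A x) A_sa A_psd ltr01.
  by move: A_le AA_le; rewrite invr1 expr0n !mul0r; lra.
have := psd_young x (A x) A_sa A_psd r_gt0.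
have : r * '[A x, x] <= r * (r * '[x]) by rewrite ler_wpM2l // ltW.
have : r^-1 * '[A (A x), A x] <= '[A x] by rewrite ler_pdivrMl.
rewrite expr2; lra.
Qed.

Lemma psd_iter_contraction (W : pred H) A r n f : self_adjoint A -> psd A ->
  0 <= r -> (forall x, W x -> W (A x)) ->
  (forall x, W x -> '[A x, x] <= r * '[x]) ->
  W f -> '[iter n A f] <= r ^+ n ^+ 2 * '[f].
Proof.
move=> A_sa A_psd r_ge0 WA A_le Wf.
have W_iter k : W (iter k A f) by elim: k => // k; exact: WA.
elim: n => [|n IHn]; first by rewrite expr0 expr1n mul1r.
rewrite iterS [r ^+ n.+1]exprS exprMn -mulrA.
apply: le_trans (ler_wpM2l (sqr_ge0 r) IHn).
by apply: psd_contraction => //; apply: A_le => //; exact: WA.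
Qed.

End InnerProduct.

(** * Sums of vectors along a path *)

Definition consecutive (i j : nat) : bool := (j == i.+1) || (i == j.+1).

Section Path.
Variables (R : realFieldType) (d : nat).

Definition path_gap : R := 4 / d.+1%:R ^+ 2.

Lemma path_gap_gt0 : 0 < path_gap.
Proof. by rewrite divr_gt0 ?exprn_gt0 ?ltr0Sn. Qed.

(* It vanishes at [-1] and at [d] and has second difference [-2]. *)
Definition path_weight (k : nat) : R := k.+1%:R * (d%:R - k%:R).

Lemma path_weight_gt0 (i : 'I_d) : 0 < path_weight i.
Proof. by rewrite mulr_gt0 ?ltr0Sn // subr_gt0 ltr_nat. Qed.

Lemma path_weight_le k : path_gap * path_weight k <= 1.
Proof.
rewrite /path_gap mulrAC ler_pdivrMr ?exprn_gt0 ?ltr0Sn // mul1r /path_weight.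
rewrite -[k.+1%:R]natr1 -[d.+1%:R]natr1.
have := sqr_ge0 (d%:R - k%:R - (k%:R + 1) : R); lra.
Qed.

Lemma sum_consecutive_path_weight (i : 'I_d) :
  \sum_(j < d | consecutive i j) path_weight j = 2 * path_weight i - 2.
Proof.
rewrite (bigID (fun j : 'I_d => j == i.+1 :> nat)) /=.
rewrite (eq_bigl (fun j : 'I_d => j == i.+1 :> nat)) => [|j]; last first.
  by rewrite orbK.
rewrite (big_ord1_eq _ path_weight).
have -> : (if (i.+1 < d)%N then path_weight i.+1 else 0) = path_weight i.+1.
  case: ltnP => // le_di.
  have -> : i.+1 = d by apply/eqP; rewrite eqn_leq le_di ltn_ord.
  by rewrite /path_weight subrr mulr0.
have -> : \sum_(j < d | consecutive i j && (j != i.+1 :> nat)) path_weight j =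
    i%:R * (d%:R - i%:R + 1).
  rewrite (eq_bigl (fun j : 'I_d => i == j.+1 :> nat)) => [|j]; last first.
    rewrite /consecutive.
    case: (eqVneq (val j) i.+1) => [->|] /=; last by rewrite andbT.
    by rewrite ltn_eqF // ltnW.
  case: i => [[|k] lt_kd] /=; first by rewrite big_pred0 ?mul0r.
  rewrite (eq_bigl (fun j : 'I_d => j == k :> nat)) => [|j]; last first.
    by rewrite eq_sym.
  rewrite (big_ord1_eq _ path_weight) ltnW // /path_weight.
  by rewrite -[k.+1%:R]natr1; ring.
by rewrite /path_weight -[i.+2%:R]natr1 -[i.+1%:R]natr1; ring.
Qed.

Lemma path_sqr_norm_sum_ge (H : vectType R) (dot : {dot H for @idfun R})
    (u : 'I_d -> H) :
  (forall (i j : 'I_d) (s : R), (i < j)%N -> 0 < s ->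
     - (2^-1 *+ (j == i.+1 :> nat)) *
       (s * dot (u i) (u i) + s^-1 * dot (u j) (u j)) <= 2 * dot (u i) (u j)) ->
  path_gap * \sum_i dot (u i) (u i) <= dot (\sum_i u i) (\sum_i u i).
Proof.
move=> corr_ge; pose c (i j : 'I_d) : R := 2^-1 *+ consecutive i j.
apply: (@sqr_norm_sum_ge _ _ _ _ _ c _ _ _ path_weight_gt0).
- by move=> i j; rewrite /c /consecutive orbC.
- move=> i j s; rewrite /c /consecutive neq_ltn => /orP[lt_ij|lt_ji] s_gt0.
    by rewrite (ltn_eqF (leqW lt_ij)) orbF; exact: corr_ge.
  rewrite (ltn_eqF (leqW lt_ji)) dotC -[s]invrK addrC invrK.
  by apply: corr_ge; rewrite ?invr_gt0.
move=> i.
have -> : \sum_(j | j != i) c i j * path_weight j = path_weight i - 1.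
  transitivity (2^-1 * \sum_(j < d | consecutive i j) path_weight j).
    rewrite mulr_sumr big_mkcond [RHS]big_mkcond; apply: eq_bigr => j _.
    have [->|_] := eqVneq j i; first by rewrite /consecutive ltn_eqF /= ?mul0r.
    by rewrite /c; case: (consecutive i j); rewrite ?mulr0n ?mul0r ?mulr1n.
  by rewrite sum_consecutive_path_weight; field.
by rewrite mulrBl mul1r lerD2l lerN2 path_weight_le.
Qed.

End Path.

(** * Functions on a finite probability space *)

Section WeightedDot.
Variables (R : realFieldType) (I : finType) (w : I -> R).
Hypothesis w_gt0 : forall x, 0 < w x.
Local Notation H := {ffun I -> R^o}.
Implicit Types f g : H.

Definition one_fun : H := [ffun=> 1].

Definition weighted_sum f g : R := \sum_x w x * ((f x : R) * (g x : R)).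

Lemma ffun_linearE a f g x : (a *: f + g) x = a * (f x : R) + (g x : R) :> R.
Proof. by rewrite !ffunE. Qed.

Lemma weighted_sum_bilinear : bilinear_for *%R (idfun \; *%R) weighted_sum.
Proof.
split=> [f a g1 g2|g a f1 f2]; rewrite /weighted_sum /= mulr_sumr -big_split /=;
  by apply: eq_bigr => x _; rewrite ffun_linearE; ring.
Qed.

Lemma weighted_sum_sym f g :
  weighted_sum f g = (-1) ^+ false * idfun (weighted_sum g f).
Proof.
by rewrite expr0 mul1r; apply: eq_bigr => x _; rewrite [f x * _]mulrC.
Qed.

Lemma weighted_sum_gt0 f : f != 0 -> 0 < weighted_sum f f.
Proof.
have term_ge0 x : 0 <= w x * ((f x : R) * (f x : R)).
  by rewrite mulr_ge0 ?(ltW (w_gt0 x)) // -expr2 sqr_ge0.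
rewrite lt_def sumr_ge0 ?andbT //; apply: contraNneq => /eqP.
rewrite psumr_eq0 // => /allP f0; apply/eqP/ffunP => x; rewrite ffunE.
have := f0 x (mem_index_enum x).
by rewrite !mulf_eq0 (gt_eqF (w_gt0 x)) orbb => /eqP.
Qed.

Definition wdot : {dot H for @idfun R} := HB.pack weighted_sum
  (bilinear_isBilinear.Build _ _ _ _ _ _ weighted_sum weighted_sum_bilinear)
  (isHermitianSesquilinear.Build _ _ _ _ weighted_sum weighted_sum_sym)
  (isDotProduct.Build _ _ weighted_sum weighted_sum_gt0).

Lemma wdotE f g : wdot f g = \sum_x w x * ((f x : R) * (g x : R)).
Proof. by []. Qed.

End WeightedDot.

Section ConditionalExpectation.
Variables (R : realFieldType) (I : finType) (w : I -> R).
Hypothesis w_gt0 : forall x, 0 < w x.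
Local Notation H := {ffun I -> R^o}.
Local Notation dot := (wdot w_gt0).
Implicit Types f g : H.

Section Fibers.
Variables (J : eqType) (k : I -> J).

Definition fiber_mass x : R := \sum_(y | k y == k x) w y.

Lemma fiber_mass_gt0 x : 0 < fiber_mass x.
Proof.
rewrite /fiber_mass (bigD1 x) //= ltr_wpDr // sumr_ge0 // => y _.
exact: ltW.
Qed.

Definition condexp_fun f : H :=
  [ffun x => (\sum_(y | k y == k x) w y * f y) / fiber_mass x].

Lemma condexp_fun_linear : linear condexp_fun.
Proof.
move=> a f g; apply/ffunP => x; rewrite [LHS]ffunE [RHS]ffun_linearE !ffunE.
rewrite mulrA -mulrDl; congr (_ / _).
rewrite mulr_sumr -big_split; apply: eq_bigr => y _ /=.
by rewrite ffun_linearE mulrDr mulrCA.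
Qed.

HB.instance Definition _ :=
  GRing.isLinear.Build R H H *:%R condexp_fun condexp_fun_linear.

Definition condexp : 'End(H) := linfun condexp_fun.

Lemma condexpE f x :
  condexp f x = (\sum_(y | k y == k x) w y * f y) / fiber_mass x.
Proof. by rewrite lfunE /= ffunE. Qed.

Lemma condexp_fiber f x y : k x = k y -> condexp f x = condexp f y.
Proof. by move=> kxy; rewrite !condexpE /fiber_mass kxy. Qed.

Lemma condexp_id f : (forall x y, k x = k y -> f x = f y) -> condexp f = f.
Proof.
move=> f_fiber; apply/ffunP => x; rewrite condexpE.
under eq_bigr => y /eqP/f_fiber -> do [].
by rewrite -mulr_suml mulrC mulKf // gt_eqF ?fiber_mass_gt0.
Qed.

Lemma condexp_self_adjoint : self_adjoint dot condexp.
Proof.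
pose joint (u v : H) x y := w y * (u y : R) * (w x * (v x : R) / fiber_mass x).
have dot_condexp u v :
    dot (condexp u) v = \sum_x \sum_(y | k y == k x) joint u v x y.
  apply: eq_bigr => x _; rewrite condexpE -[RHS]mulr_suml /=.
  have swap (a b c e : R) : a * (b / c * e) = b * (a * e / c) by ring.
  exact: swap.
move=> f g; rewrite [RHS]dotC !dot_condexp [RHS](exchange_big_dep xpredT) //=.
apply: eq_bigr => x _.
rewrite (eq_bigl (fun y => k x == k y)) => [|y]; last by rewrite eq_sym.
apply: eq_bigr => y /eqP kxy; rewrite /joint /fiber_mass kxy.
have swap (a b c e z : R) : a * b * (c * e / z) = c * e * (a * b / z) by ring.
exact: swap.
Qed.

Lemma condexp_projection : orthogonal_projection dot condexp.
Proof.
by split=> [|f]; [exact: condexp_self_adjoint | exact/condexp_id/condexp_fiber].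
Qed.

Lemma wdot_condexp f g : dot f g = \sum_x w x * condexp [ffun y => f y * g y] x.
Proof.
transitivity (dot (one_fun R I) (condexp [ffun y => f y * g y])).
  rewrite -condexp_self_adjoint condexp_id => [|x y _]; last by rewrite !ffunE.
  by apply: eq_bigr => x _; rewrite !ffunE mul1r.
by apply: eq_bigr => x _; rewrite ffunE mul1r.
Qed.

End Fibers.

Lemma condexp_absorb (J J' : eqType) (k : I -> J) (k' : I -> J') f :
  (forall x y, k x = k y -> k' x = k' y) ->
  condexp k (condexp k' f) = condexp k' f.
Proof. by move=> kk'; apply: condexp_id => x y /kk'; exact: condexp_fiber. Qed.

End ConditionalExpectation.

Section ReversibleWalk.
Variables (R : realFieldType) (I : finType) (w : I -> R).
Hypothesis w_gt0 : forall x, 0 < w x.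
Hypothesis w_sum : \sum_x w x = 1.
Local Notation H := {ffun I -> R^o}.
Local Notation dot := (wdot w_gt0).
Local Notation one := (one_fun R I).
Implicit Types f g : H.

Definition indicator (x : I) : H := [ffun y => (y == x)%:R].

Definition mean f : R := \sum_x w x * f x.

Definition variance f : R := \sum_x w x * (f x : R) ^+ 2 - mean f ^+ 2.

Lemma dot_one f : dot f one = mean f.
Proof. by apply: eq_bigr => x _; rewrite ffunE mulr1. Qed.

Lemma mean_one : mean one = 1.
Proof. by rewrite -w_sum; apply: eq_bigr => x _; rewrite ffunE mulr1. Qed.

Lemma dot_indicator f x : dot f (indicator x) = w x * f x.
Proof.
rewrite wdotE (bigD1 x) //= ffunE eqxx mulr1 big1 ?addr0 // => y /negPf yx.
by rewrite ffunE yx !mulr0.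
Qed.

Lemma varianceE f : variance f = dot f f - mean f ^+ 2.
Proof. by []. Qed.

Lemma dot_sub_const f a :
  dot (f - a *: one) (f - a *: one) = variance f + (mean f - a) ^+ 2.
Proof.
rewrite !(dotBl, dotBr, dotZl, dotZr) [dot one f]dotC !dot_one mean_one.
by rewrite varianceE; ring.
Qed.

Lemma variance_ge0 f : 0 <= variance f.
Proof.
have := dot_ge0 dot (f - mean f *: one).
by rewrite dot_sub_const subrr expr0n addr0.
Qed.

Variable M : 'End(H).
Hypothesis M_sa : self_adjoint dot M.
Hypothesis M_one : M one = one.

Lemma mean_walk f : mean (M f) = mean f.
Proof. by rewrite -!dot_one M_sa M_one. Qed.

Lemma dirichlet_form (K : I -> I -> R) f :
  (forall g x, M g x = \sum_y K x y * g y) ->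
  2^-1 * \sum_x \sum_y w x * K x y * ((f x : R) - (f y : R)) ^+ 2 =
  dot f f - dot (M f) f.
Proof.
move=> ME; pose f2 : H := [ffun x => (f x : R) ^+ 2].
have sumK x : \sum_y K x y = 1.
  have := ME one x; rewrite M_one ffunE => ->.
  by apply: eq_bigr => y _; rewrite ffunE mulr1.
have sum_fx2 : \sum_x \sum_y w x * K x y * (f x : R) ^+ 2 = dot f f.
  by apply: eq_bigr => x _; rewrite -mulr_suml -mulr_sumr sumK mulr1.
have sum_fy2 : \sum_x \sum_y w x * K x y * (f y : R) ^+ 2 = dot f f.
  transitivity (mean (M f2)).
    apply: eq_bigr => x _; rewrite ME mulr_sumr.
    by apply: eq_bigr => y _; rewrite ffunE mulrA.
  by rewrite mean_walk; apply: eq_bigr => x _; rewrite ffunE.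
have sum_fxy :
    \sum_x \sum_y w x * K x y * ((f x : R) * (f y : R)) = dot (M f) f.
  rewrite dotC; apply: eq_bigr => x _; rewrite ME !mulr_sumr.
  by apply: eq_bigr => y _; rewrite -!mulrA; congr (_ * _); rewrite mulrCA.
transitivity (2^-1 * (dot f f + dot f f - 2 * dot (M f) f)); last by field.
congr (_ * _); rewrite -{1}sum_fx2 -sum_fy2 -sum_fxy.
rewrite -big_split mulr_sumr -sumrB /=.
apply: eq_bigr => x _.
rewrite -big_split mulr_sumr -sumrB; apply: eq_bigr => y _ /=; ring.
Qed.

Lemma iter_walk_self_adjoint n f g : dot (iter n M f) g = dot f (iter n M g).
Proof. by elim: n f g => // n IHn f g; rewrite iterS M_sa IHn -iterSr. Qed.

(* [iter n M (indicator y) x] is the probability of going from [x] to [y] in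
   [n] steps; by reversibility, its density with respect to [w], as a function
   of [y], evolves by [M] too, from the density of the point mass at [x]. *)
Definition centered_density (x : I) : H := (w x)^-1 *: indicator x - one.

Lemma iter_walk_sub_stationary n x y :
  iter n M (indicator y) x - w y = w y * iter n M (centered_density x) y.
Proof.
have iter_one : iter n M one = one.
  by elim: n => //= n ->; exact: M_one.
have -> : iter n M (centered_density x) =
    (w x)^-1 *: iter n M (indicator x) - one.
  rewrite -[X in _ - X]iter_one; elim: (n) => //= m ->.
  by rewrite linearB linearZ.
have detailed_balance :
    w x * iter n M (indicator y) x = w y * iter n M (indicator x) y.
  by rewrite -!dot_indicator iter_walk_self_adjoint dotC.
have -> : iter n M (indicator y) x =
    (w x)^-1 * (w y * iter n M (indicator x) y).
  by rewrite -detailed_balance mulKf ?gt_eqF.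
rewrite !ffunE mulrBr mulr1; congr (_ - _).
by rewrite mulrCA.
Qed.

Lemma mean_centered_density x : mean (centered_density x) = 0.
Proof.
rewrite -dot_one dotBl dotZl [dot (indicator x) _]dotC dot_indicator !dot_one.
by rewrite ffunE mulr1 mulVf ?gt_eqF // mean_one subrr.
Qed.

Lemma dot_centered_density x :
  dot (centered_density x) (centered_density x) = (w x)^-1 - 1.
Proof.
rewrite {2}/centered_density dotBr dot_one mean_centered_density subr0.
rewrite dotZr dot_indicator mulKf ?gt_eqF //.
by rewrite !ffunE eqxx [_ *: _]mulr1.
Qed.

Lemma l1_sqr_le n x : (\sum_y `|iter n M (indicator y) x - w y|) ^+ 2 <=
  dot (iter n M (centered_density x)) (iter n M (centered_density x)).
Proof.
set u := iter n M _; pose a : H := [ffun y => `|(u y : R)|].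
have -> : \sum_y `|iter n M (indicator y) x - w y| = mean a.
  apply: eq_bigr => y _.
  by rewrite iter_walk_sub_stationary normrM gtr0_norm // ffunE.
have -> : dot u u = dot a a.
  by apply: eq_bigr => y _; rewrite ffunE -!expr2 real_normK // num_real.
by have := variance_ge0 a; rewrite varianceE subr_ge0.
Qed.

Hypothesis M_psd : psd dot M.
Variable gam : R.
Hypothesis gam_le1 : gam <= 1.
Hypothesis poincare : forall f, gam * variance f <= dot f f - dot (M f) f.

Lemma iter_walk_contraction n f : mean f = 0 ->
  dot (iter n M f) (iter n M f) <= (1 - gam) ^+ n ^+ 2 * dot f f.
Proof.
move=> f_mean; apply: (psd_iter_contraction (W := fun g => mean g == 0)) => //.
- by rewrite subr_ge0.
- by move=> g; rewrite mean_walk.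
- move=> g /eqP g_mean; have := poincare g.
  by rewrite varianceE g_mean expr0n subr0; lra.
- exact/eqP.
Qed.

(* The factor 2, which comes from [4 w (1 - w) <= 1], leaves room for rounding
   the number of steps down. *)
Lemma l1_mixing n x eps : 0 < eps -> (1 - gam) ^+ n <= 2 * (eps * w x) ->
  \sum_y `|iter n M (indicator y) x - w y| <= eps.
Proof.
move=> eps_gt0 n_large; have w_ge0 := ltW (w_gt0 x).
rewrite -(@ler_pXn2r _ 2) ?nnegrE ?(ltW eps_gt0) ?sumr_ge0 //.
apply: le_trans (l1_sqr_le n x) _.
apply: le_trans (iter_walk_contraction n (mean_centered_density x)) _.
have density_ge0 := dot_ge0 dot (centered_density x).
rewrite dot_centered_density in density_ge0 *.
have sqr_n_large : (1 - gam) ^+ n ^+ 2 <= (2 * (eps * w x)) ^+ 2.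
  rewrite ler_pXn2r ?nnegrE ?exprn_ge0 ?subr_ge0 // !mulr_ge0 //; exact: ltW.
apply: le_trans (ler_wpM2r density_ge0 sqr_n_large) _.
have -> : (2 * (eps * w x)) ^+ 2 * ((w x)^-1 - 1) =
    eps ^+ 2 * (4 * (w x * (1 - w x))).
  by field; rewrite gt_eqF.
rewrite -[leRHS]mulr1 ler_wpM2l ?sqr_ge0 //.
have := sqr_ge0 (2 * w x - 1); lra.
Qed.

End ReversibleWalk.

(** * Facets and links of a weighted pure complex *)

Section Links.
Variables (R : realType) (V : finType) (X : {set {set V}}) (d : nat).
Variable mu : {set V} -> R.
Hypothesis X_complex : simplicial_complex X.
Hypothesis X_pure : pure X d.
Hypothesis mu_dist : facet_distribution X d mu.

Local Notation facet := {x : {set V} | x \in faces X d}.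
Implicit Types (x y z : facet) (s t : {set V}) (u v : V).

Lemma facet_in x : val x \in X.
Proof. by have := valP x; rewrite inE => /andP[]. Qed.

Lemma card_facet x : #|val x| = d.
Proof. by have := valP x; rewrite inE => /andP[_ /eqP]. Qed.

Lemma face_in_facet s : s \in X -> exists x : facet, s \subset val x.
Proof.
move=> sX; have [r r_max sr] := maxset_exists (P := mem X) sX.
have rX : r \in X by case/maxsetP: r_max.
have rF : r \in faces X d by rewrite inE rX; apply/eqP/X_pure.
by exists (exist _ r rF).
Qed.

Lemma facet_maximal x : is_facet X (val x).
Proof.
apply/maxsetP; split=> [|s sX xs]; first exact: facet_in.
have [y sy] := face_in_facet sX.
apply/eqP; rewrite eq_sym eqEcard xs card_facet -(card_facet y).
exact: subset_leq_card.
Qed.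

Lemma linkP t s :
  reflect (exists2 y : facet, t \subset val y & s \subset val y :\: t)
          (s \in link X t).
Proof.
apply: (iffP imsetP) => [[r /[!inE] /andP[rX tr] ->]|[y ty]].
  have [y ry] := face_in_facet rX.
  by exists y; rewrite ?setSD ?(fintype.subset_trans tr).
rewrite subsetD => /andP[sy st]; exists (s :|: t).
  rewrite inE subsetUr andbT; apply: X_complex (facet_in y) _.
  by rewrite subUset sy.
by rewrite setDUl setDv setU0; apply/esym/setDidPl.
Qed.

Lemma link_vertexP t v :
  reflect (exists2 y : facet, t \subset val y & v \in val y :\: t)
          (v \in vertices (link X t)).
Proof.
rewrite inE; apply: (iffP (linkP _ _)) => -[y ty vy]; exists y => //.
  by rewrite -sub1set.
by rewrite sub1set.
Qed.

Lemma link_edgeP t u v :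
  reflect (u != v /\ exists y : facet,
             [/\ t \subset val y, u \in val y :\: t & v \in val y :\: t])
          (link_edge X t u v).
Proof.
rewrite /link_edge inE cards2.
apply: (iffP andP) => [[/linkP[y ty]]|[uv [y [ty uy vy]]]].
  rewrite subUset !sub1set => /andP[uy vy].
  by case: (u != v) => // _; split=> //; exists y.
rewrite uv; split=> //; apply/linkP.
by exists y; rewrite // subUset !sub1set uy.
Qed.

Lemma card_facetD t x : t \subset val x -> #|val x :\: t| = codim d t.
Proof. by move=> tx; rewrite cardsDS // card_facet. Qed.

Section Connected.
Variable f : facet -> R.
Hypothesis f_ridge : forall t x y, codim d t = 1%N ->
  t \subset val x -> t \subset val y -> f x = f y.

Lemma link_path_constant t u p x y :
  (forall v x' y', v \in val x' :\: t -> v \in val y' :\: t ->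
     t \subset val x' -> t \subset val y' -> f x' = f y') ->
  path (link_edge X t) u p -> t \subset val x -> u \in val x :\: t ->
  t \subset val y -> last u p \in val y :\: t -> f x = f y.
Proof.
move=> f_shared; elim: p u x => [|v p IHp] u x /=.
  by move=> _ tx ux ty uy; exact: (f_shared u).
move=> /andP[/link_edgeP[_ [z [tz uz vz]]] v_path] tx ux ty y_last.
by rewrite (f_shared u x z) //; exact: IHp v_path tz vz ty y_last.
Qed.

(* By induction on the codimension of [t], [f] agrees on facets that share [t]
   and one more vertex; a path in the link graph of [t] chains such facets. *)
Lemma ridge_invariant_constant x y : connected_complex X d -> f x = f y.
Proof.
move=> X_conn.
suff constant_above n t x' y' : codim d t = n ->
    t \subset val x' -> t \subset val y' -> f x' = f y'.
  by apply: (constant_above _ set0); rewrite ?sub0set.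
elim: n t x' y' => [|[|n] IHn] t x' y' codim_t tx ty.
- have t_full z : t \subset val z -> val z = t.
    move=> tz; apply/eqP; rewrite eqEsubset tz andbT -setD_eq0 -cards_eq0.
    by rewrite card_facetD // codim_t.
  by have -> : x' = y' by apply: val_inj; rewrite (t_full x' tx) (t_full y' ty).
- exact: f_ridge codim_t tx ty.
have tX : t \in X by apply: X_complex (facet_in x') tx.
have codim_ge2 : (1 < codim d t)%N by rewrite codim_t.
have vertex_above z : t \subset val z -> exists v, v \in val z :\: t.
  by move=> tz; apply/set0Pn; rewrite -card_gt0 card_facetD // codim_t.
have [u ux] := vertex_above x' tx; have [v vy] := vertex_above y' ty.
have [||p u_path vE] := connectP (X_conn t tX codim_ge2 u v _ _).
- by apply/link_vertexP; exists x'.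
- by apply/link_vertexP; exists y'.
apply: (link_path_constant _ u_path tx ux ty); last by rewrite -vE.
move=> r z1 z2; rewrite !in_setD => /andP[rt r1] /andP[_ r2] t1 t2.
apply: (IHn (r |: t)); rewrite ?subUset ?sub1set ?r1 ?r2 //.
by rewrite /codim cardsU1 rt add1n subnS -/(codim d t) codim_t.
Qed.

End Connected.

Lemma mu_gt0 x : 0 < mu (val x).
Proof. by case: mu_dist => mu_pos _; exact/mu_pos/valP. Qed.

Lemma mu_sum : \sum_(x : facet) mu (val x) = 1.
Proof. by case: mu_dist => _ <-; rewrite (big_sub (mem (faces X d))). Qed.

Definition cexpect t (F : facet -> R) : R :=
  (\sum_(y : facet | t \subset val y) mu (val y) * F y) /
  \sum_(y : facet | t \subset val y) mu (val y).

Lemma eq_cexpect t (F G : facet -> R) :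
  (forall y, t \subset val y -> F y = G y) -> cexpect t F = cexpect t G.
Proof. by move=> FG; congr (_ / _); apply: eq_bigr => y /FG ->. Qed.

Lemma cexpect_sum t (J : Type) (r : seq J) (P : pred J) (F : J -> facet -> R) :
  cexpect t (fun y => \sum_(j <- r | P j) F j y) =
  \sum_(j <- r | P j) cexpect t (F j).
Proof.
rewrite -mulr_suml exchange_big /=; congr (_ / _).
by apply: eq_bigr => y _; rewrite mulr_sumr.
Qed.

Lemma cexpectMl t a (F : facet -> R) :
  cexpect t (fun y => a * F y) = a * cexpect t F.
Proof.
rewrite /cexpect mulrA mulr_sumr; congr (_ / _).
by apply: eq_bigr => y _; rewrite mulrCA.
Qed.

Lemma cexpectMr t a (F : facet -> R) :
  cexpect t (fun y => F y * a) = cexpect t F * a.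
Proof.
by rewrite mulrC -cexpectMl; apply: eq_cexpect => y _; rewrite mulrC.
Qed.

Lemma cexpectD t (F G : facet -> R) :
  cexpect t (fun y => F y + G y) = cexpect t F + cexpect t G.
Proof.
rewrite -mulrDl -big_split; congr (_ / _).
by apply: eq_bigr => y _; rewrite mulrDr.
Qed.

Lemma cexpect_ge0 t (F : facet -> R) : (forall y, 0 <= F y) -> 0 <= cexpect t F.
Proof.
move=> F_ge0; rewrite divr_ge0 ?sumr_ge0 // => y _; last by rewrite ltW ?mu_gt0.
by rewrite mulr_ge0 // ltW ?mu_gt0.
Qed.

Lemma cexpect_gt0 t (F : facet -> R) x : (forall y, 0 <= F y) ->
  t \subset val x -> 0 < F x -> 0 < cexpect t F.
Proof.
move=> F_ge0 tx Fx.
rewrite divr_gt0 // (bigD1 x) //= ltr_wpDr ?mulr_gt0 ?mu_gt0 //.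
  by apply: sumr_ge0 => y _; rewrite mulr_ge0 // ltW ?mu_gt0.
by apply: sumr_ge0 => y _; rewrite ltW ?mu_gt0.
Qed.

Lemma cprobE t (A : pred {set V}) :
  cprob X d mu A t = cexpect t (fun y => (A (val y))%:R).
Proof.
rewrite /cprob /prob !(big_sub_cond (mem (faces X d))); congr (_ / _).
rewrite [LHS]big_mkcond [RHS]big_mkcond; apply: eq_bigr => y _ /=.
by case: (A _); case: (t \subset _); rewrite ?mulr1 ?mulr0.
Qed.

Lemma link_weightE t u v : link_weight X d mu t u v =
  cexpect t (fun y => [&& u != v, u \in val y :\: t & v \in val y :\: t]%:R).
Proof.
rewrite /link_weight; case: link_edgeP => [[uv [z [_ uz vz]]]|not_edge].
  rewrite cprobE; apply: eq_cexpect => y ty; rewrite uv !inE.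
  by move: uz vz; rewrite !inE => /andP[-> _] /andP[-> _].
transitivity (cexpect t (fun=> 0 * 0)); first by rewrite cexpectMl mul0r.
apply: eq_cexpect => y ty; rewrite mul0r; case: and3P => // -[uv uy vy].
by case: not_edge; split=> //; exists y.
Qed.

Lemma link_weight_sum t (h : V -> V -> R) :
  \sum_(u in vertices (link X t)) \sum_(v in vertices (link X t))
    link_weight X d mu t u v * h u v =
  cexpect t (fun y =>
    \sum_(u in val y :\: t) \sum_(v in (val y :\: t) :\ u) h u v).
Proof.
under eq_bigr => u _ do under eq_bigr => v _ do rewrite link_weightE -cexpectMr.
under eq_bigr => u _ do rewrite -cexpect_sum.
rewrite -cexpect_sum; apply: eq_cexpect => y ty.
have vertexP v : v \in val y :\: t -> v \in vertices (link X t).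
  by move=> vy; apply/link_vertexP; exists y.
rewrite big_mkcond [RHS]big_mkcond; apply: eq_bigr => u _ /=.
have [uy|uy] := boolP (u \in val y :\: t); last first.
  by case: ifP => // _; rewrite big1 // => v _; rewrite andbF mul0r.
rewrite vertexP // big_mkcond [RHS]big_mkcond; apply: eq_bigr => v _ /=.
rewrite in_setD1 [v == u]eq_sym; case: (boolP (v \in val y :\: t)) => [vy|_].
  by rewrite vertexP // andbT; case: (u != v); rewrite ?mul1r ?mul0r.
by rewrite !andbF mul0r if_same.
Qed.

Lemma link_weightC t u v : link_weight X d mu t u v = link_weight X d mu t v u.
Proof.
rewrite !link_weightE; apply: eq_cexpect => y _.
by rewrite eq_sym [X in _ && X]andbC.
Qed.

Lemma link_degree_gt0 t u : (1 < codim d t)%N -> u \in vertices (link X t) ->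
  0 < \sum_(v in vertices (link X t)) link_weight X d mu t u v.
Proof.
move=> codim_t /link_vertexP[y ty uy].
have [v] : exists v, v \in (val y :\: t) :\ u.
  apply/set0Pn; move: codim_t.
  by rewrite -(card_facetD ty) (cardsD1 u) uy ltnS card_gt0.
rewrite in_setD1 => /andP[vu vy].
rewrite (bigD1 v) /=; last by apply/link_vertexP; exists y.
rewrite ltr_wpDr //.
  by apply: sumr_ge0 => z _; rewrite link_weightE cexpect_ge0.
by rewrite link_weightE (cexpect_gt0 (x := y)) // eq_sym vu uy vy ltr01.
Qed.

Lemma link_form_le t (g : V -> R) (alpha : R) :
  top_link_expander X d mu alpha -> alpha < 1 -> t \in X -> codim d t = 2 ->
  cexpect t (fun y => \sum_(u in val y :\: t) g u) = 0 ->
  cexpect t (fun y =>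
    \sum_(u in val y :\: t) \sum_(v in (val y :\: t) :\ u) g u * g v) <=
  alpha * cexpect t (fun y => \sum_(u in val y :\: t) g u ^+ 2).
Proof.
move=> X_exp alpha_lt1 tX codim_t g_mean.
set A := vertices (link X t).
pose W : 'M[R]_#|A| :=
  \matrix_(i, j) link_weight X d mu t (enum_val i) (enum_val j).
have W_sym : W^T = W by apply/matrixP => i j; rewrite !mxE link_weightC.
have degE i : \sum_j W i j =
    \sum_(v in A) link_weight X d mu t (enum_val i) v.
  by rewrite [RHS]big_enum_val; apply: eq_bigr => j _; rewrite mxE.
have deg_gt0 i : 0 < \sum_j W i j.
  by rewrite degE link_degree_gt0 ?codim_t ?enum_valP.
have walkE i j : link_walk X d mu t i j = W i j / \sum_k W i k.
  by rewrite degE !mxE.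
have deg_sum (h : V -> R) : \sum_i (\sum_j W i j) * h (enum_val i) =
    cexpect t (fun y => \sum_(u in val y :\: t) h u).
  transitivity (\sum_(u in A) \sum_(v in A) link_weight X d mu t u v * h u).
    rewrite [RHS]big_enum_val; apply: eq_bigr => i _.
    by rewrite degE mulr_suml.
  rewrite link_weight_sum; apply: eq_cexpect => y ty; apply: eq_bigr => u uy.
  rewrite sumr_const (_ : #|_| = 1%N) //.
  by move: codim_t; rewrite -(card_facetD ty) (cardsD1 u) uy => -[].
have := reversible_lambda2_le W_sym deg_gt0 walkE alpha_lt1
  (X_exp t tX codim_t).
move=> /(_ (g \o enum_val)); rewrite deg_sum => /(_ g_mean).
rewrite (deg_sum (fun u => g u ^+ 2)); congr (_ <= _).
rewrite -link_weight_sum [RHS]big_enum_val; apply: eq_bigr => i _.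
by rewrite [RHS]big_enum_val; apply: eq_bigr => j _; rewrite mxE.
Qed.

End Links.

(** * Partite complexes *)

Lemma factor_through (I : finType) (J : eqType) (K : Type) (k0 : K)
    (P : pred I) (f : I -> J) (a : I -> K) :
  (forall x y, P x -> P y -> f x = f y -> a x = a y) ->
  exists g, forall x, P x -> g (f x) = a x.
Proof.
move=> f_a; exists (fun j => oapp a k0 [pick x | P x && (f x == j)]) => x Px.
case: pickP => [y /andP[Py /eqP fyx]|/(_ x)] /=; first exact: f_a.
by rewrite Px eqxx.
Qed.

Section Partite.
Variables (R : realType) (V : finType) (X : {set {set V}}) (d : nat).
Variables (T : 'I_d -> {set V}) (mu : {set V} -> R).
Hypothesis X_complex : simplicial_complex X.
Hypothesis X_pure : pure X d.
Hypothesis X_partite : partite X T.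
Hypothesis mu_dist : facet_distribution X d mu.

Local Notation facet := {x : {set V} | x \in faces X d}.
Implicit Types (x y z : facet) (i j k : 'I_d) (S : {set 'I_d}) (v : V).

Lemma part_disjoint i j v : v \in T i -> v \in T j -> i = j.
Proof.
move=> vi vj; apply: contraTeq vi => ij.
have [_ /(_ i j ij) Tij _] := X_partite.
by rewrite (disjointFl Tij vj).
Qed.

Lemma part_vertex_exists i x : exists v, v \in val x :&: T i.
Proof.
have [_ _ /(_ _ (facet_maximal X_pure x) i)/eqP/cards1P[v ->]] := X_partite.
by exists v; rewrite inE.
Qed.

Definition part_vertex i x : V := xchoose (part_vertex_exists i x).

Lemma part_vertex_in i x : part_vertex i x \in val x.
Proof. by have /setIP[] := xchooseP (part_vertex_exists i x). Qed.

Lemma part_vertex_part i x : part_vertex i x \in T i.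
Proof. by have /setIP[] := xchooseP (part_vertex_exists i x). Qed.

Lemma part_vertex_uniq i x v : v \in val x -> v \in T i -> part_vertex i x = v.
Proof.
move=> vx vi.
have [_ _ /(_ _ (facet_maximal X_pure x) i)/eqP/cards1P[u x_i]] := X_partite.
have /set1P -> : v \in [set u] by rewrite -x_i inE vx.
by apply/set1P; rewrite -x_i inE part_vertex_in part_vertex_part.
Qed.

Lemma part_vertex_inj x : injective (part_vertex^~ x).
Proof.
move=> i j ij; apply: part_disjoint (part_vertex_part i x) _.
by rewrite ij part_vertex_part.
Qed.

Lemma mem_facetP x v : reflect (exists i, v = part_vertex i x) (v \in val x).
Proof.
apply: (iffP idP) => [vx|[i ->]]; last exact: part_vertex_in.
have [vertexP _ _] := X_partite.
have /vertexP[i vi] : v \in vertices X.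
  by rewrite inE; apply: X_complex (facet_in x) _; rewrite sub1set.
by exists i; rewrite (part_vertex_uniq vx vi).
Qed.

Lemma mem_part_vertex i x y :
  (part_vertex i x \in val y) = (part_vertex i y == part_vertex i x).
Proof.
apply/idP/eqP => [xy|<-]; last exact: part_vertex_in.
exact: part_vertex_uniq xy (part_vertex_part i x).
Qed.

Definition subface S x : {set V} := [set part_vertex i x | i in S].

Lemma subface_sub S x : subface S x \subset val x.
Proof.
by apply/fintype.subsetP => _ /imsetP[i _ ->]; exact: part_vertex_in.
Qed.

Lemma subface_in S x : subface S x \in X.
Proof. exact: X_complex (facet_in x) (subface_sub S x). Qed.

Lemma card_subface S x : #|subface S x| = #|S|.
Proof. exact/card_imset/part_vertex_inj. Qed.

Lemma subface_subsetP S x y :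
  reflect {in S, forall i, part_vertex i y = part_vertex i x}
          (subface S x \subset val y).
Proof.
apply: (iffP fintype.subsetP) => [xy i iS|xy _ /imsetP[i iS ->]].
  apply/eqP; rewrite -mem_part_vertex; apply: xy.
  by apply/imsetP; exists i.
by rewrite mem_part_vertex xy.
Qed.

Lemma subface_eq S x y :
  (subface S y == subface S x) = (subface S x \subset val y).
Proof.
apply/eqP/subface_subsetP => [xy|xy]; last exact: eq_in_imset.
by apply/subface_subsetP; rewrite -xy subface_sub.
Qed.

Lemma subfaceS S S' x y : S' \subset S -> subface S x = subface S y ->
  subface S' x = subface S' y.
Proof.
move=> /fintype.subsetP S'S /eqP; rewrite subface_eq => /subface_subsetP xy.
by apply/eqP; rewrite subface_eq; apply/subface_subsetP => i /S'S /xy.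
Qed.

Lemma facetD_subface S x y : subface (~: S) x \subset val y ->
  val y :\: subface (~: S) x = subface S y.
Proof.
rewrite -subface_eq => /eqP <-; apply/setP => v.
apply/setDP/imsetP => [[/mem_facetP[i ->] iS]|[i iS ->]].
  exists i => //; apply: contraR iS => iS.
  by apply/imsetP; exists i; rewrite ?inE.
split; first exact: part_vertex_in.
apply/imsetP => -[j jS /part_vertex_inj ij].
by move: jS; rewrite inE -ij iS.
Qed.

Lemma codim_subface S x : codim d (subface (~: S) x) = #|S|.
Proof.
by rewrite /codim card_subface -[X in (X - _)%N](card_ord d) -(cardsC S) addnK.
Qed.

Lemma ridge_subface t x : codim d t = 1%N -> t \subset val x ->
  exists i, t = subface (~: [set i]) x.
Proof.
move=> codim_t tx.
have /eqP/cards1P[v x_t] : #|val x :\: t| = 1%N by rewrite card_facetD.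
have /mem_facetP[i vE] : v \in val x.
  by have /setDP[] : v \in val x :\: t by rewrite x_t inE.
exists i; apply/eqP; rewrite eq_sym eqEcard; apply/andP; split.
  apply/fintype.subsetP => _ /imsetP[j ji ->]; apply: contraLR ji => jt.
  have : part_vertex j x \in val x :\: t by rewrite inE jt part_vertex_in.
  by rewrite x_t vE !inE negbK => /eqP/part_vertex_inj ->.
rewrite card_subface cardsC1 card_ord -(card_facet x) -subn1 -codim_t.
by rewrite -(card_facetD tx) cardsDS // subKn // subset_leq_card.
Qed.

Lemma replaces_subface i x y :
  replaces T i (val x) (val y) = (subface (~: [set i]) x \subset val y).
Proof.
apply/existsP/subface_subsetP => [[u /andP[ui /eqP yE]] j|xy].
  rewrite !inE => ji; apply/eqP.
  rewrite -mem_part_vertex yE !inE part_vertex_in andbT.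
  apply/orP; right; apply: contra ji => ji.
  by rewrite (part_disjoint ji (part_vertex_part j x)).
exists (part_vertex i y); rewrite part_vertex_part eqEsubset /=.
apply/andP; split; apply/fintype.subsetP => v; rewrite !inE.
  move=> /mem_facetP[j ->].
  have [->|ji] := eqVneq j i; first by rewrite eqxx.
  rewrite (xy j) ?inE // part_vertex_in andbT orbC.
  rewrite (contra _ ji) // => ji'; apply/eqP.
  exact: part_disjoint (part_vertex_part j x) ji'.
case/predU1P => [->|/andP[vi /mem_facetP[j vE]]]; first exact: part_vertex_in.
rewrite vE -xy ?part_vertex_in // !inE; apply: contraNneq vi => <-.
by rewrite vE part_vertex_part.
Qed.

Lemma subface_sum i j x y (F : V -> R) : i != j ->
  subface (~: [set i; j]) x \subset val y ->
  \sum_(u in val y :\: subface (~: [set i; j]) x) F u =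
  F (part_vertex i y) + F (part_vertex j y).
Proof.
move=> ij xy; rewrite facetD_subface // big_imset /=; last first.
  by move=> ? ? _ _ /part_vertex_inj.
by rewrite big_setU1 ?big_set1 // inE.
Qed.

Lemma subface_sum_neq i j x y (g : V -> R) : i != j ->
  subface (~: [set i; j]) x \subset val y ->
  let t := subface (~: [set i; j]) x in
  \sum_(u in val y :\: t) \sum_(v in (val y :\: t) :\ u) g u * g v =
  2 * (g (part_vertex i y) * g (part_vertex j y)).
Proof.
move=> ij xy t; set c := g (part_vertex i y) + g (part_vertex j y).
transitivity (\sum_(u in val y :\: t) g u * (c - g u)).
  apply: eq_bigr => u uy; rewrite -mulr_sumr /c -(subface_sum g ij xy).
  by rewrite [in RHS](big_setD1 u) //= addrAC subrr add0r.
by rewrite subface_sum // /c; ring.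
Qed.

Definition part_invariant i (a : facet -> R) :=
  forall x y, subface (~: [set i]) x = subface (~: [set i]) y -> a x = a y.

Lemma part_invariant_constant (f : facet -> R) : connected_complex X d ->
  (forall i, part_invariant i f) -> forall x y, f x = f y.
Proof.
move=> X_conn f_inv x y.
apply: (ridge_invariant_constant X_complex X_pure _ _ _ X_conn).
move=> t x' y' codim_t tx; have [i ->] := ridge_subface codim_t tx.
by rewrite -subface_eq => /eqP/esym/f_inv.
Qed.

Lemma part_invariant_factor i j x (a : facet -> R) :
  let t := subface (~: [set i; j]) x in part_invariant i a ->
  exists g, forall y, t \subset val y -> g (part_vertex j y) = a y.
Proof.
move=> t a_inv; apply: (factor_through 0) => y z ty tz yz_j; apply: a_inv.
apply/eqP; rewrite eq_sym subface_eq; apply/subface_subsetP => k.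
rewrite !inE => ki.
have [->//|kj] := eqVneq k j.
move: ty tz => /subface_subsetP ty /subface_subsetP tz.
by rewrite ty ?tz ?inE ?negb_or ?ki.
Qed.

Lemma part_invariant_potential i j x (a b : facet -> R) : i != j ->
  let t := subface (~: [set i; j]) x in
  part_invariant i a -> part_invariant j b ->
  exists g : V -> R, forall y, t \subset val y ->
    g (part_vertex j y) = a y /\ g (part_vertex i y) = b y.
Proof.
move=> ij t a_inv b_inv.
have [ga gaE] := part_invariant_factor j x a_inv.
have [gb gbE] := part_invariant_factor i x b_inv.
exists (fun v => if v \in T j then ga v else gb v) => y ty; split.
  by rewrite part_vertex_part gaE.
rewrite ifN ?gbE //; first by rewrite setUC.
apply: contra ij => /part_disjoint.
by move=> /(_ _ (part_vertex_part i y)) ->.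
Qed.

Definition correlation_le i j (eps : R) : Prop :=
  forall x (a b : facet -> R), let t := subface (~: [set i; j]) x in
  part_invariant i a -> part_invariant j b ->
  cexpect mu t a = 0 -> cexpect mu t b = 0 ->
  2 * cexpect mu t (fun y => a y * b y) <=
  eps * (cexpect mu t (fun y => a y ^+ 2) + cexpect mu t (fun y => b y ^+ 2)).

Lemma expander_correlation_le i j (alpha : R) : i != j ->
  top_link_expander X d mu alpha -> alpha < 1 -> correlation_le i j alpha.
Proof.
move=> ij X_exp alpha_lt1 x a b t a_inv b_inv a_mean b_mean.
have [g gE] := part_invariant_potential x ij a_inv b_inv.
have codim_t : codim d t = 2 by rewrite codim_subface cards2 ij.
have := link_form_le (g := g) X_complex X_pure mu_dist X_exp alpha_lt1
  (subface_in _ x) codim_t.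
have -> : cexpect mu t (fun y => \sum_(u in val y :\: t) g u) =
    cexpect mu t a + cexpect mu t b.
  rewrite -cexpectD; apply: eq_cexpect => y ty.
  by have [ga gb] := gE y ty; rewrite subface_sum // ga gb addrC.
rewrite a_mean b_mean addr0 => /(_ erefl).
have -> : cexpect mu t (fun y => \sum_(u in val y :\: t)
    \sum_(v in (val y :\: t) :\ u) g u * g v) =
    2 * cexpect mu t (fun y => a y * b y).
  rewrite -cexpectMl; apply: eq_cexpect => y ty.
  by have [ga gb] := gE y ty; rewrite subface_sum_neq // ga gb [b y * _]mulrC.
have -> : cexpect mu t (fun y => \sum_(u in val y :\: t) g u ^+ 2) =
    cexpect mu t (fun y => a y ^+ 2) + cexpect mu t (fun y => b y ^+ 2).
  rewrite -cexpectD; apply: eq_cexpect => y ty.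
  by have [ga gb] := gE y ty; rewrite subface_sum // ga gb addrC.
exact.
Qed.

Lemma part_vertex_sum i y (g : V -> R) :
  \sum_(u in T i) (u \in val y)%:R * g u = g (part_vertex i y).
Proof.
rewrite (bigD1 (part_vertex i y)) ?part_vertex_part //= part_vertex_in mul1r.
rewrite big1 ?addr0 // => u /andP[ui].
have [uy|_] := boolP (u \in val y); last by rewrite mul0r.
by rewrite (part_vertex_uniq uy ui) eqxx.
Qed.

Lemma cexpect_independent i j (t : {set V}) (g h : V -> R) :
  (forall u v, u \in T i -> v \in T j ->
     cprob X d mu (fun s => (u \in s) && (v \in s)) t =
     cprob X d mu (fun s => u \in s) t * cprob X d mu (fun s => v \in s) t) ->
  cexpect mu t (fun y : facet => g (part_vertex i y) * h (part_vertex j y)) =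
  cexpect mu t (fun y : facet => g (part_vertex i y)) *
  cexpect mu t (fun y : facet => h (part_vertex j y)).
Proof.
move=> indep.
have cexpect_part k (f : V -> R) :
    cexpect mu t (fun y : facet => f (part_vertex k y)) =
    \sum_(u in T k) cprob X d mu (fun s => u \in s) t * f u.
  under eq_bigr => u _ do rewrite cprobE -cexpectMr.
  by rewrite -cexpect_sum; apply: eq_cexpect => y _; rewrite part_vertex_sum.
rewrite !cexpect_part big_distrlr /=.
under [RHS]eq_bigr => u ui do under eq_bigr => v vj do
  rewrite mulrACA -indep // cprobE -cexpectMr.
under [RHS]eq_bigr => u _ do rewrite -cexpect_sum.
rewrite -cexpect_sum; apply: eq_cexpect => y _.
rewrite -!part_vertex_sum big_distrlr /=.
apply: eq_bigr => u _; apply: eq_bigr => v _.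
by rewrite -mulnb natrM; ring.
Qed.

Lemma independent_correlation_le i j : i != j ->
  (forall x u v, let t := subface (~: [set i; j]) x in u \in T i -> v \in T j ->
     cprob X d mu (fun s => (u \in s) && (v \in s)) t =
     cprob X d mu (fun s => u \in s) t * cprob X d mu (fun s => v \in s) t) ->
  correlation_le i j 0.
Proof.
move=> ij indep x a b t a_inv b_inv a_mean _; rewrite mul0r.
have [g gE] := part_invariant_potential x ij a_inv b_inv.
have -> : cexpect mu t (fun y => a y * b y) =
    cexpect mu t (fun y => g (part_vertex i y) * g (part_vertex j y)).
  by apply: eq_cexpect => y ty; have [-> ->] := gE y ty; rewrite mulrC.
rewrite cexpect_independent; last by move=> u v; exact: indep.
have -> : cexpect mu t (fun y => g (part_vertex j y)) = cexpect mu t a.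
  by apply: eq_cexpect => y ty; have [-> _] := gE y ty.
by rewrite a_mean !mulr0.
Qed.

Lemma path_correlation_le :
  path_complex X T mu -> top_link_expander X d mu (1 / 2) ->
  exists p : 'S_d, forall i j, (i < j)%N ->
    correlation_le (p i) (p j) (2^-1 *+ (j == i.+1 :> nat)).
Proof.
move=> [p p_path] X_exp; exists p => i j lt_ij.
have ij : p i != p j by rewrite (inj_eq perm_inj) neq_ltn lt_ij.
have [jE|ji] := eqVneq (val j) i.+1.
  by rewrite mulr1n -div1r; apply: expander_correlation_le => //; lra.
apply: independent_correlation_le => // x u v t ui vj.
have lt_Sij : (i.+1 < j)%N by rewrite ltn_neqAle eq_sym ji.
apply: (p_path i j lt_Sij) => //; first exact: subface_in.
pose k := Ordinal (ltn_trans lt_Sij (ltn_ord j)).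
exists k; first by rewrite /= ltnSn.
apply/set0Pn; exists (part_vertex (p k) x); rewrite inE part_vertex_part andbT.
apply/imsetP; exists (p k) => //.
rewrite !inE !(inj_eq perm_inj) -!val_eqE /=.
by rewrite negb_or (gtn_eqF (ltnSn i)) (ltn_eqF lt_Sij).
Qed.

End Partite.

(** * Numerical bounds on the gap *)

Section DownUpGap.
Variable R : realType.

Definition down_up_gap (d : nat) : R := 4 / (d * d.+1 ^ 2)%:R.

Lemma down_up_gap_gt0 d : (0 < d)%N -> 0 < down_up_gap d.
Proof. by move=> d_gt0; rewrite divr_gt0 // ltr0n muln_gt0 d_gt0 expn_gt0. Qed.

Lemma down_up_gap_le d d' :
  (0 < d')%N -> (d' <= d)%N -> down_up_gap d <= down_up_gap d'.
Proof.
move=> d'_gt0 le_d'd; have d_gt0 := leq_trans d'_gt0 le_d'd.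
have den_gt0 m : (0 < m)%N -> 0 < (m * m.+1 ^ 2)%:R :> R.
  by move=> m_gt0; rewrite ltr0n muln_gt0 m_gt0 expn_gt0.
rewrite ler_wpM2l // lef_pV2 ?posrE ?den_gt0 // ler_nat leq_mul //.
by rewrite leq_exp2r.
Qed.

Lemma down_up_gap_le1 d : (0 < d)%N -> down_up_gap d <= 1.
Proof.
move=> d_gt0; apply: le_trans (down_up_gap_le (ltn0Sn 0) d_gt0) _.
by rewrite /down_up_gap mul1n natrX divff // expf_neq0 // pnatr_eq0.
Qed.

Lemma down_up_gap_le_half d : (1 < d)%N -> down_up_gap d <= 1 / 2.
Proof.
move=> d_gt1; apply: le_trans (down_up_gap_le (ltn0Sn 1) d_gt1) _.
rewrite /down_up_gap; lra.
Qed.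

Lemma down_up_gapE d : down_up_gap d = d%:R^-1 * path_gap R d.
Proof. by rewrite /down_up_gap /path_gap natrM natrX invfM mulrCA. Qed.

Lemma expr_one_sub_le_expR (x : R) n :
  x <= 1 -> (1 - x) ^+ n <= expR (- (x * n%:R)).
Proof.
move=> x_le1; rewrite -mulNr expRM_natr lerXn2r ?nnegrE ?subr_ge0 ?expR_ge0 //.
exact: expR_ge1Dx.
Qed.

Lemma expR_le2 (x : R) : x <= 1 / 2 -> expR x <= 2.
Proof.
move=> x_le; rewrite -[leLHS]invrK -expRN -[leRHS]invrK.
rewrite lef_pV2 ?posrE ?invr_gt0 ?expR_gt0 //.
apply: le_trans (expR_ge1Dx _); lra.
Qed.

End DownUpGap.

(** * The down-up walk *)

Section DownUpWalk.
Variables (R : realType) (V : finType) (X : {set {set V}}) (d : nat).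
Variables (T : 'I_d -> {set V}) (mu : {set V} -> R).
Hypothesis d_gt0 : (0 < d)%N.
Hypothesis X_complex : simplicial_complex X.
Hypothesis X_pure : pure X d.
Hypothesis X_partite : partite X T.
Hypothesis mu_dist : facet_distribution X d mu.

Local Notation facet := {x : {set V} | x \in faces X d}.
Local Notation H := {ffun facet -> R^o}.
Local Notation w := (fun x : facet => mu (val x)).
Local Notation dot := (wdot (mu_gt0 mu_dist)).
Local Notation one := (one_fun R facet).
Local Notation subface := (subface X_pure X_partite).
Implicit Types (x y : facet) (i j : 'I_d) (S : {set 'I_d}) (f g : H).

Definition resample S : 'End(H) := condexp w (subface (~: S)).
Local Notation Q := resample.

Lemma resampleE S f x : Q S f x = cexpect mu (subface (~: S) x) f.
Proof.
rewrite condexpE /fiber_mass /cexpect.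
by rewrite !(eq_bigl _ _ (fun y => subface_eq X_pure X_partite (~: S) x y)).
Qed.

Lemma resample_projection S : orthogonal_projection dot (Q S).
Proof. exact: condexp_projection. Qed.

Lemma resample_absorb S S' f : S \subset S' -> Q S (Q S' f) = Q S' f.
Proof.
move=> SS'; apply: (condexp_absorb (mu_gt0 mu_dist)) => x y.
by apply: subfaceS; rewrite setCS.
Qed.

Lemma resample_invariant i f :
  Q [set i] f = f -> part_invariant X_pure X_partite i f.
Proof. by move=> <- x y; exact: condexp_fiber. Qed.

Lemma wdot_cexpect S f g :
  dot f g = \sum_x w x * cexpect mu (subface (~: S) x) (fun y => f y * g y).
Proof.
rewrite (wdot_condexp _ (subface (~: S))); apply: eq_bigr => x _.
rewrite -/(resample S) resampleE; congr (_ * _).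
by apply: eq_cexpect => y _; rewrite ffunE.
Qed.

Lemma resample_correlation_ge i j (eps s : R) f : 0 <= eps -> eps <= 1 ->
  correlation_le mu X_pure X_partite i j eps -> 0 < s ->
  - eps * (s * dot (f - Q [set i] f) (f - Q [set i] f) +
           s^-1 * dot (f - Q [set j] f) (f - Q [set j] f)) <=
  2 * dot (f - Q [set i] f) (f - Q [set j] f).
Proof.
move=> eps_ge0 eps_le1 corr s_gt0.
apply: (complement_correlation_ge (resample_projection [set i])
  (resample_projection [set j]) (resample_projection [set i; j])) => //.
- by move=> g; rewrite resample_absorb // sub1set !inE eqxx.
- by move=> g; rewrite resample_absorb // sub1set !inE eqxx orbT.
move=> a b Qa Qb Qij_a Qij_b; have mean0 (g : H) x : Q [set i; j] g = 0 ->
    cexpect mu (subface (~: [set i; j]) x) g = 0.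
  by move=> Qij_g; rewrite -resampleE Qij_g ffunE.
rewrite !(wdot_cexpect [set i; j]) -big_split !mulr_sumr /=.
apply: ler_sum => x _; rewrite -mulrDr mulrCA [leRHS]mulrCA.
rewrite ler_wpM2l ?(ltW (mu_gt0 mu_dist x)) //.
exact: corr (resample_invariant Qa) (resample_invariant Qb)
  (mean0 a x Qij_a) (mean0 b x Qij_b).
Qed.

Definition laplacian : 'End(H) := \sum_i (\1%VF - Q [set i]).
Local Notation L := laplacian.

Lemma laplacianE f : L f = \sum_i (f - Q [set i] f).
Proof.
rewrite sum_lfunE; apply: eq_bigr => i _.
by rewrite add_lfunE opp_lfunE id_lfunE.
Qed.

Lemma laplacian_dot f :
  dot (L f) f = \sum_i dot (f - Q [set i] f) (f - Q [set i] f).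
Proof.
rewrite laplacianE dot_suml; apply: eq_bigr => i _.
by rewrite (dot_complement f (resample_projection [set i])) dotBl.
Qed.

Lemma laplacian_self_adjoint : self_adjoint dot L.
Proof.
move=> f g; rewrite !laplacianE dot_suml dot_sumr; apply: eq_bigr => i _.
by have [Q_sa _] := resample_projection [set i]; rewrite dotBl dotBr Q_sa.
Qed.

Lemma laplacian_psd : psd dot L.
Proof.
by move=> f; rewrite laplacian_dot; apply: sumr_ge0 => i _; exact: dot_ge0.
Qed.

Lemma laplacian_ker f : connected_complex X d -> L f = 0 ->
  f = mean w f *: one.
Proof.
move=> X_conn Lf; have f_inv i : part_invariant X_pure X_partite i f.
  apply: resample_invariant; apply/esym/eqP; rewrite -subr_eq0 -(dot_eq0 dot).
  have := laplacian_dot f; rewrite Lf dot0l => /esym/eqP.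
  rewrite psumr_eq0 => [/allP/(_ i (mem_index_enum i))//|k _].
  exact: dot_ge0.
apply/ffunP => x; rewrite !ffunE [RHS]mulr1 -[LHS]mul1r -(mu_sum mu_dist).
rewrite mulr_suml; apply: eq_bigr => y _; congr (_ * _).
by have := part_invariant_constant X_complex X_conn f_inv x y.
Qed.

Definition walk : 'End(H) := d%:R^-1 *: \sum_i Q [set i].
Local Notation M := walk.

Lemma walkE f : M f = d%:R^-1 *: \sum_i Q [set i] f.
Proof. by rewrite scale_lfunE sum_lfunE. Qed.

Lemma walk_kernel f x :
  M f x = \sum_(y : facet) down_up X T mu (val x) (val y) * f y.
Proof.
transitivity (\sum_i d%:R^-1 * (Q [set i] f x : R)).
  by rewrite walkE ffunE sum_ffunE -[RHS]mulr_sumr.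
transitivity (\sum_i \sum_(y : facet) d%:R^-1 *
  ((if replaces T i (val x) (val y)
    then w y / \sum_(r in faces X d | replaces T i (val x) r) mu r
    else 0) * f y)).
  apply: eq_bigr => i _; rewrite resampleE -mulr_sumr; congr (_ * _).
  rewrite /cexpect mulr_suml big_mkcond; apply: eq_bigr => y _.
  rewrite (big_sub_cond (mem (faces X d)) (replaces T i (val x))).
  have replacesE := replaces_subface X_complex X_pure X_partite i x.
  rewrite (eq_bigl _ _ replacesE) replacesE.
  by case: ifP; rewrite ?mul0r // mulrAC.
rewrite exchange_big; apply: eq_bigr => y _; rewrite mulr_suml.
by apply: eq_bigr => i _; rewrite mulrA.
Qed.

Lemma walk_self_adjoint : self_adjoint dot M.
Proof.
move=> f g; rewrite !walkE dotZl dotZr dot_suml dot_sumr; congr (_ * _).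
by apply: eq_bigr => i _; have [Q_sa _] := resample_projection [set i].
Qed.

Lemma walk_psd : psd dot M.
Proof.
move=> f; rewrite walkE dotZl dot_suml mulr_ge0 ?invr_ge0 ?ler0n //.
apply: sumr_ge0 => i _.
by rewrite -(dot_projection f (resample_projection [set i])) dot_ge0.
Qed.

Let d_neq0 : d%:R != 0 :> R. Proof. by rewrite pnatr_eq0 -lt0n. Qed.

Lemma walk_one : M one = one.
Proof.
rewrite walkE (eq_bigr (fun=> one)) => [|i _].
  by rewrite sumr_const card_ord -scaler_nat scalerA mulVf // scale1r.
by apply: (condexp_id (mu_gt0 mu_dist)) => x y _; rewrite !ffunE.
Qed.

Lemma laplacian_walk f : dot (L f) f = d%:R * (dot f f - dot (M f) f).
Proof.
rewrite laplacianE walkE dotZl !dot_suml mulrBr mulVKf //.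
under eq_bigr => i _ do rewrite dotBl.
by rewrite sumrB sumr_const card_ord mulr_natl.
Qed.

Lemma dirichletE (h : {set V} -> R) :
  let f : H := [ffun x => h (val x)] in
  dirichlet X T mu h = dot f f - dot (M f) f.
Proof.
move=> f; rewrite -(dirichlet_form walk_self_adjoint walk_one _ walk_kernel).
rewrite /dirichlet (big_sub (mem (faces X d))).
congr (_ * _); apply: eq_bigr => x _.
by rewrite (big_sub (mem (faces X d))); apply: eq_bigr => y _; rewrite !ffunE.
Qed.

Lemma variance_onE (h : {set V} -> R) :
  variance_on X d mu h = variance w [ffun x => h (val x)].
Proof.
rewrite /variance_on !(big_sub (mem (faces X d))).
by congr (_ - _ ^+ 2); apply: eq_bigr => x _; rewrite !ffunE.
Qed.

Lemma down_up_iterE n x y :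
  down_up_iter X T mu n (val x) (val y) = iter n M (indicator R y) x.
Proof.
elim: n x => [|n IHn] x /=; first by rewrite ffunE.
rewrite walk_kernel (big_sub (mem (faces X d))); apply: eq_bigr => z _.
by rewrite IHn.
Qed.

Lemma l1_distanceE n x :
  l1_distance X T mu (val x) n = \sum_y `|iter n M (indicator R y) x - w y|.
Proof.
rewrite /l1_distance (big_sub (mem (faces X d))).
by apply: eq_bigr => y _; rewrite down_up_iterE.
Qed.

Hypothesis X_connected : connected_complex X d.
Hypothesis X_path : path_complex X T mu.
Hypothesis X_expander : top_link_expander X d mu (1 / 2).

Lemma laplacian_sqr_ge f : path_gap R d * dot (L f) f <= dot (L f) (L f).
Proof.
have [p corr] := path_correlation_le X_complex X_pure X_partite mu_dist
  X_path X_expander.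
rewrite laplacian_dot laplacianE (reindex_inj (@perm_inj _ p)).
rewrite [X in dot X X](reindex_inj (@perm_inj _ p)).
apply: path_sqr_norm_sum_ge => i j s lt_ij s_gt0.
apply: resample_correlation_ge (corr i j lt_ij) s_gt0;
  by case: (_ == _); rewrite ?mulr1n ?mulr0n; lra.
Qed.

Lemma laplacian_poincare f : path_gap R d * variance w f <= dot (L f) f.
Proof.
have [f0 Lf0] := psd_spectral_gap f laplacian_self_adjoint laplacian_psd
  (path_gap_gt0 R d) laplacian_sqr_ge.
apply: le_trans; rewrite ler_wpM2l ?(ltW (path_gap_gt0 R d)) //.
rewrite (laplacian_ker X_connected Lf0) dot_sub_const ?mu_sum //.
by rewrite lerDl sqr_ge0.
Qed.

Local Notation gap := (down_up_gap R d).

Lemma walk_poincare f : gap * variance w f <= dot f f - dot (M f) f.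
Proof.
rewrite down_up_gapE -mulrA ler_pdivrMl ?ltr0n // -laplacian_walk.
exact: laplacian_poincare.
Qed.

Lemma spectral_gap_ge : (gap%:E <= spectral_gap X T mu)%E.
Proof.
apply/ereal_infP => _ [h [x [y [xF yF hxy]]] ->]; rewrite lee_fin.
rewrite dirichletE variance_onE; set f : H := [ffun z => h (val z)].
have var_gt0 : 0 < variance w f.
  have := dot_sub_const (mu_gt0 mu_dist) (mu_sum mu_dist) f (mean w f).
  rewrite subrr expr0n addr0 => <-; apply: dot_gt0.
  apply/eqP => /subr0_eq/ffunP f_const.
  apply: hxy; have := f_const (exist _ x xF); have := f_const (exist _ y yF).
  by rewrite !ffunE /= => -> ->.
by rewrite ler_pdivlMr //; exact: walk_poincare.
Qed.

Section Mixing.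
Variables (x : facet) (eps : R).
Hypothesis eps_gt0 : 0 < eps.
Local Notation bound := (mixing_bound d mu (val x) eps).

Let eps_mu_gt0 : 0 < eps * w x. Proof. by rewrite mulr_gt0 ?mu_gt0. Qed.

Lemma expR_mixing_bound : expR (- (gap * bound)) = eps * w x.
Proof.
have d_sqr_neq0 : (d * d.+1 ^ 2)%:R != 0 :> R.
  by rewrite pnatr_eq0 -lt0n muln_gt0 d_gt0 expn_gt0.
have -> : gap * bound = ln (1 / (eps * w x)).
  rewrite /down_up_gap /mixing_bound !mulrA divfK // divff ?pnatr_eq0 //.
  by rewrite !mul1r.
by rewrite div1r lnV ?posrE // opprK lnK ?posrE.
Qed.

Lemma mixing_time_le_nat n : gap * (bound - n%:R) <= 1 / 2 ->
  (mixing_time X T mu (val x) eps <= n%:R%:E)%E.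
Proof.
move=> n_large; apply: ereal_inf_lbound; exists n => //; rewrite l1_distanceE.
have gap_le1 := down_up_gap_le1 R d_gt0.
apply: (l1_mixing (mu_sum mu_dist) walk_self_adjoint walk_one walk_psd
  gap_le1 walk_poincare eps_gt0).
apply: le_trans (expr_one_sub_le_expR n gap_le1) _.
have -> : - (gap * n%:R) = gap * (bound - n%:R) - gap * bound by ring.
by rewrite expRD expR_mixing_bound ler_wpM2r ?expR_le2 // ltW.
Qed.

Lemma mixing_time_le_bound : (1 < d)%N -> eps * w x <= 1 ->
  (mixing_time X T mu (val x) eps <= bound%:E)%E.
Proof.
move=> d_gt1 ew_le1.
have bound_ge0 : 0 <= bound.
  by rewrite mulr_ge0 ?divr_ge0 ?ler0n // ln_ge0 // div1r invf_ge1.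
have /andP[floor_le lt_floor] := truncn_itv bound_ge0.
apply: le_trans (_ : (Num.truncn bound)%:R%:E <= _)%E; last by rewrite lee_fin.
apply: mixing_time_le_nat; apply: le_trans (down_up_gap_le_half R d_gt1).
rewrite -[leRHS]mulr1 ler_wpM2l ?ltW ?down_up_gap_gt0 //.
by move: lt_floor; rewrite -natr1; lra.
Qed.

Lemma mixing_time_le_ceil :
  (mixing_time X T mu (val x) eps <= (Num.max 0 (Num.ceil bound))%:~R%:E)%E.
Proof.
set m := Num.max _ _; have m_ge0 : 0 <= m by rewrite le_max lexx.
rewrite -[m]gez0_abs // -pmulrn; apply: mixing_time_le_nat.
apply: (@le_trans _ _ 0); last by rewrite divr_ge0.
rewrite mulr_ge0_le0 ?(ltW (down_up_gap_gt0 R d_gt0)) //.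
rewrite subr_le0 pmulrn gez0_abs //.
by apply: le_trans (ceil_ge _) _; rewrite ler_int le_max lexx orbT.
Qed.

End Mixing.

End DownUpWalk.

Theorem mainTheorem3 (R : realType) (V : finType) (X : {set {set V}})
    (d : nat) (T : 'I_d -> {set V}) (mu : {set V} -> R)
    (d_gt0 : (0 < d)%N)
    (X_complex : simplicial_complex X)
    (X_pure : pure X d)
    (X_partite : partite X T)
    (mu_dist : facet_distribution X d mu)
    (X_connected : connected_complex X d)
    (X_path : path_complex X T mu)
    (X_expander : top_link_expander X d mu (1 / 2)) :
  ((4 / (d * d.+1 ^ 2)%:R)%:E <= spectral_gap X T mu)%E /\
  forall (tau : {set V}) (eps : R), tau \in faces X d -> 0 < eps ->
    ((1 < d)%N -> eps * mu tau <= 1 ->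
       (mixing_time X T mu tau eps <= (mixing_bound d mu tau eps)%:E)%E) /\
    (mixing_time X T mu tau eps <=
       ((Num.max 0 (Num.ceil (mixing_bound d mu tau eps)))%:~R)%:E)%E.
Proof.
split=> [|tau eps tau_facet eps_gt0]; first exact: spectral_gap_ge.
pose x : {s : {set V} | s \in faces X d} := exist _ tau tau_facet.
rewrite -[tau]/(val x).
by split; [exact: mixing_time_le_bound | exact: mixing_time_le_ceil].
Qed.
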